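(* Let $k_1\ge1$ be an odd integer and $k_3\ge 1$ an integer. For $1\le p\le q\le k_1+k_3$ let $\mathbf{e}(p,q)$ be the index of length $k_1+k_3$ obtained from $(1,\dots,1)$ by adding $1$ to the entry in position $p$ and adding $1$ to the entry in position $q$ (so if $p=q$ that entry equals $3$). Then $$\tilde T(1)\sum_{\substack{l_1+l_2+l_3=k_1\\ l_1>0}}\ \sum_{\substack{m_1+m_2+m_3=k_3\\ m_3>0}}\binom{l_1+m_1}{l_1}\binom{l_2+m_2}{l_2}\binom{l_3+m_3}{l_3}\,\mathbb{E}(k_1,l_1)\,\mathbb{E}(k_3,m_3)\,\tilde T\bigl(\mathbf{e}(l_3+m_3,\;l_3+m_3+l_2+m_2)\bigr)$$ $$=\begin{cases}\tilde T(k_1+1,1)\,\tilde T(k_3+1)-\tilde T(k_1+1,1,k_3+1)&(k_3 \text{ odd}),\\ \tilde T(k_1+1,1)\,T(k_3+1)+T(k_1+1,1,k_3+1)&(k_3\text{ even}),\end{cases}$$ where the sums run over non-negative integers $l_1,l_2,l_3$ and $m_1,m_2,m_3$ subject to the indicated conditions.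
   Context: Multiple $T$-values: for $\mathbf{k}=(k_1,\dots,k_r)\in\mathbb{Z}_{\ge1}^r$ with $k_r>1$, $T(\mathbf{k})=2^r\sum \frac{1}{m_1^{k_1}\cdots m_r^{k_r}}$, the sum over integers $0<m_1<\cdots<m_r$ with $m_j\equiv j \pmod 2$ for all $j$. Multiple $\tilde T$-values: for $\mathbf{k}=(k_1,\dots,k_r)\in\mathbb{Z}_{\ge1}^r$, $\tilde T(\mathbf{k})=2^r\sum\frac{(-1)^{(m_r-r)/2}}{m_1^{k_1}\cdots m_r^{k_r}}$, the sum over integers $0<m_1<\cdots<m_r$ with $m_j\equiv j\pmod 2$ for all $j$ (when $k_r=1$ the series is understood as the limit as $M\to\infty$ of the partial sums over $m_r\le M$). $\mathbb{E}(k,j)$ (Entringer number) is the number of permutations $\sigma\in\mathfrak{S}_{k+1}$ with $\sigma(1)=j+1$ that are down-up, i.e. for $1\le i\le k$: $\sigma(i)<\sigma(i+1)$ if and only if $i$ is even. *)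

(* Defs.v *)
From mathcomp Require Import all_boot all_order all_algebra all_fingroup.
From mathcomp Require Import all_classical all_reals all_analysis.

Set Implicit Arguments.
Unset Strict Implicit.
Unset Printing Implicit Defensive.

Import Order.TTheory GRing.Theory Num.Theory.
Import numFieldNormedType.Exports.

Local Open Scope ring_scope.

(* Tuples 0 < m_1 < ... < m_r <= M with m_j = j mod 2; position j is stored
   0-based, so the entry of tuple index j is m_(j+1). *)
Definition alternating_tuple (r M : nat) (m : r.-tuple 'I_M.+1) : bool :=
  path ltn 0%N [seq nat_of_ord x | x <- m] &&
  [forall j : 'I_r, odd (tnth m j) == odd j.+1].

Definition mono_term (R : realType) (k : seq nat) (M : nat)
    (m : (size k).-tuple 'I_M.+1) : R :=
  \prod_(j < size k) ((nat_of_ord (tnth m j))%:R ^+ nth 0%N k j)^-1.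

Definition mtv_partial (R : realType) (k : seq nat) (M : nat) : R :=
  2 ^+ size k *
  \sum_(m : (size k).-tuple 'I_M.+1 | alternating_tuple m) mono_term R m.

(* On the range of summation m_r >= r and m_r = r mod 2, so the truncated
   subtraction and the halving in the exponent are exact. *)
Definition mttv_partial (R : realType) (k : seq nat) (M : nat) : R :=
  2 ^+ size k *
  \sum_(m : (size k).-tuple 'I_M.+1 | alternating_tuple m)
     (-1) ^+ (last 0%N [seq nat_of_ord x | x <- m] - size k)./2 *
     mono_term R m.

(* The series are limits of the partial sums over m_r <= M; for a last entry
   > 1 they converge absolutely, so this is the usual sum. *)
Definition mtv (R : realType) (k : seq nat) : R := limn (mtv_partial R k).

Definition mttv (R : realType) (k : seq nat) : R := limn (mttv_partial R k).

(* Values and positions are 0-based: sigma(1) = j + 1 reads s ord0 = j, and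
   "sigma(i) < sigma(i+1) iff i is even" becomes, at 0-based i, "iff i is
   odd". *)
Definition entringer (k j : nat) : nat :=
  #|[set s : 'S_k.+1 | (nat_of_ord (s ord0) == j) &&
      [forall i : 'I_k,
         (s (widen_ord (leqnSn k) i) < s (lift ord0 i))%N == odd i]]|.

(* (1,...,1) of length n with 1 added at the 1-based positions p and q. *)
Definition bump_index (n p q : nat) : seq nat :=
  mkseq (fun i => 1 + (i.+1 == p) + (i.+1 == q))%N n.

(* Main.v *)
(* Put [c = pi / 2] and [t = tan (theta / 2)].  Integrating [t^m] repeatedly
   against [d theta] and [d theta / sin theta] over [0 < theta < c] gives
   functionals [nint m ks] with
     nint m (k :: ks) + nint (m + 2) (k :: ks) = 2 / (m + 1)^k nint (m + 1) ks,
   the recursion in the starting point [m] of the alternating nested sums; the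
   boundary terms are negligible, so [mttv ks = nint 0 ks].  The double sum of
   the theorem therefore collapses to
     int_0^c P_k1(y) / sin y  int_0^y P_k3(c - x) / sin x  dx dy,
   with the Entringer polynomials [P_k], which satisfy [P_k' (y) = - P_(k-1) (c - y)]
   and [P_k (c) = 0] for [k > 0].
   On the other side, for [f (0) = 0] the cosine coefficients of [f / sin]
   telescope, with increments twice the sine coefficients of [f].  Used for the
   inner integrand and for its primitive, this turns the cosine coefficients of
   the outer integrand into nested sums, and expanding [P_k1] in the cosines of
   odd multiples of [y] gives the triple sum. *)

Require Import Defs.
From mathcomp Require Import all_boot all_order all_algebra all_fingroup.
From mathcomp Require Import all_classical all_reals all_analysis.
From mathcomp Require Import ring lra zify.
Import Order.TTheory GRing.Theory Num.Theory.
Import numFieldNormedType.Exports.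
Local Open Scope classical_set_scope.
Local Open Scope ring_scope.

Set Implicit Arguments.
Unset Strict Implicit.
Unset Printing Implicit Defensive.

(** * Primitives on [0, pi/2] *)

Section QuarterPeriod.
Variable R : realType.
Implicit Types (f g h F G : R -> R) (x y : R).
Local Notation c := (pi / 2 : R).

(** Several of the series converge only conditionally, so sums and integrals are never interchanged
    in the limit. Instead, a Fourier coefficient (or a value [nint m ks]) and the matching sum cut
    off at [M] obey the same two-step recursion in the starting point. Their difference is
    propagated downward from [M], where it is small, and each level multiplies the error inherited
    from the previous one by at most order log M. The oddness of [k1] enters through the cosine
    coefficients of P_k1, which are then 1 / n^(k1 + 1) at every odd n, with no alternating sign.
    The parity of [k3] enters only as a sign s = (-1)^k3, kept as a parameter of the nested sums, so
    both cases of the theorem come from one limit. The factor T~(1) = c is twice the squared norm c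
    / 2 of cos (n y), n odd, on [0, c]. The product on the right-hand side is the boundary term at c
    of one integration by parts. *)

Definition cont0c f := forall x, 0 <= x <= c -> {for x, continuous f}.

Definition clamp x : R := Num.max 0 (Num.min x c).

(* The lower limit [-1] makes [prim f] differentiable from both sides at [0];
   [clamp] makes the integrand continuous everywhere. *)
Definition prim f x : R :=
  (\int[@lebesgue_measure R]_(t in `[(-1), x]) f (clamp t))%R -
  (\int[@lebesgue_measure R]_(t in `[(-1), 0]) f (clamp t))%R.

Lemma c_gt0 : 0 < c.
Proof. by rewrite divr_gt0 ?pi_gt0. Qed.

Lemma clamp_id x : 0 <= x <= c -> clamp x = x.
Proof. by case/andP=> x0 xc; rewrite /clamp min_l // max_r. Qed.

Lemma clamp_itv x : 0 <= clamp x <= c.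
Proof.
rewrite /clamp le_max lexx /= ge_max (ltW c_gt0) /=.
by rewrite ge_min lexx orbT.
Qed.

Lemma clamp_continuous : continuous clamp.
Proof.
move=> x; rewrite /clamp.
apply: (@continuous_max _ _ (fun=> 0) (fun x : R => Num.min x c)).
  exact: cvg_cst.
apply: (@continuous_min _ _ (fun x => x) (fun=> c)).
  exact: cvg_id.
exact: cvg_cst.
Qed.

Lemma cont0c_clamp f : cont0c f -> continuous (f \o clamp).
Proof.
move=> gf x; apply: continuous_comp; first exact: clamp_continuous.
exact/gf/clamp_itv.
Qed.

Lemma prim_is_derive f x : cont0c f -> 0 <= x <= c -> is_derive x 1 (prim f) (f x).
Proof.
move=> gf xc; have [x0 _] := andP xc.
have cf := cont0c_clamp gf.
have [] := @continuous_FTC1_closed R (f \o clamp) (-1) x (x + 1).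
- by rewrite ltrDl.
- apply: continuous_compact_integrable; first exact: segment_compact.
  exact: continuous_subspaceT.
- by rewrite (lt_le_trans _ x0).
- exact: cf.
rewrite derive1E => d1 d2.
have -> : f x = f (clamp x) - 0 by rewrite subr0 clamp_id.
rewrite -[f (clamp x)]d2.
apply: (@is_deriveB _ _ _ (fun y => \int[lebesgue_measure]_(t in `[(-1), y]) (f \o clamp) t)%R).
exact/derivableP.
Qed.

Lemma is_derive_cont f x d : is_derive x 1 f d -> {for x, continuous f}.
Proof. by move=> [df _]; exact/differentiable_continuous/derivable1_diffP. Qed.

Lemma prim_cont0c f : cont0c f -> cont0c (prim f).
Proof. by move=> gf x xc; apply: is_derive_cont; exact: prim_is_derive. Qed.

Lemma prim0 f : prim f 0 = 0.
Proof. by rewrite /prim subrr. Qed.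

Lemma cont0c_cst a : cont0c (fun=> a).
Proof. by move=> x _; exact: cvg_cst. Qed.

Lemma cont0cD f g : cont0c f -> cont0c g -> cont0c (fun x => f x + g x).
Proof. by move=> gf gg x xc; apply: cvgD; [exact: gf|exact: gg]. Qed.

Lemma cont0cN f : cont0c f -> cont0c (fun x => - f x).
Proof. by move=> gf x xc; apply: cvgN; exact: gf. Qed.

Lemma cont0cB f g : cont0c f -> cont0c g -> cont0c (fun x => f x - g x).
Proof. by move=> gf gg; apply: cont0cD => //; exact: cont0cN. Qed.

Lemma cont0cM f g : cont0c f -> cont0c g -> cont0c (fun x => f x * g x).
Proof. by move=> gf gg x xc; apply: cvgM; [exact: gf|exact: gg]. Qed.

Lemma cont0cX f n : cont0c f -> cont0c (fun x => f x ^+ n).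
Proof.
move=> gf; elim: n => [|n IH]; first exact: cont0c_cst.
have -> : (fun x => f x ^+ n.+1) = (fun x => f x * f x ^+ n).
  by apply/funext => x; rewrite exprS.
exact: cont0cM.
Qed.

Lemma cont0c_sum (I : Type) (r : seq I) (P : pred I) (F : I -> R -> R) :
  (forall i, P i -> cont0c (F i)) -> cont0c (fun x => \sum_(i <- r | P i) F i x).
Proof.
move=> gF; elim: r => [|i r IH].
  have -> : (fun x => \sum_(i <- [::] | P i) F i x) = fun=> 0.
    by apply/funext => x; rewrite big_nil.
  exact: cont0c_cst.
have -> : (fun x => \sum_(j <- i :: r | P j) F j x) =
    fun x => (if P i then F i x else 0) + \sum_(j <- r | P j) F j x.
  by apply/funext => x; rewrite big_cons; case: ifP => //; rewrite add0r.
by apply: cont0cD => //; case: (P i) (gF i) => [|_]; [exact|exact: cont0c_cst].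
Qed.

Lemma nonneg_derive_nondecreasing f (d : R -> R) x : cont0c f ->
  (forall y, 0 < y < c -> is_derive y 1 f (d y)) ->
  (forall y, 0 < y < c -> 0 <= d y) -> 0 <= x <= c -> f 0 <= f x.
Proof.
move=> gf df d0 /andP[x0 xc].
have sub y : y \in `]0, x[%R -> 0 < y < c.
  by rewrite in_itv /= => /andP[-> /lt_le_trans->].
rewrite -subr_ge0.
move: x0; rewrite le_eqVlt => /predU1P[<-|x0]; first by rewrite subrr.
have [||w wx ->] := @MVT R f d 0 x x0.
- by move=> y /sub; exact: df.
- apply: continuous_in_subspaceT => y; rewrite inE /= in_itv /= => /andP[y0 yx].
  by apply: gf; rewrite y0 (le_trans yx).
by rewrite subr0 mulr_ge0 ?d0 ?sub // ltW.
Qed.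

(** The difference [F - prim f] has zero derivative inside, so the mean value theorem, applied to it
    and to its opposite, makes it constant. Asking for the derivative only on the open interval
    suits [dsin], whose quotient formula fails at 0. From here on integrals are evaluated by
    exhibiting a primitive. *)
Lemma prim_unique f F x : cont0c f -> cont0c F ->
  (forall y, 0 < y < c -> is_derive y 1 F (f y)) ->
  0 <= x <= c -> prim f x = F x - F 0.
Proof.
move=> gf gF dF xc.
have wk y : 0 < y < c -> 0 <= y <= c by case/andP=> /ltW -> /ltW ->.
have gP := prim_cont0c gf.
have gD : cont0c (fun y => F y - prim f y) by exact: cont0cB.
have dD y : 0 < y < c -> is_derive y 1 (fun z => F z - prim f z) 0.
  move=> yc; rewrite -(subrr (f y)); apply: is_deriveB; first exact: dF.
  by apply: prim_is_derive => //; exact: wk.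
have h1 := @nonneg_derive_nondecreasing _ (fun=> 0) x gD dD.
have dN y : 0 < y < c -> is_derive y 1 (fun z => - (F z - prim f z)) 0.
  by move=> /dD dy; rewrite -oppr0; exact: is_deriveN.
have h2 := @nonneg_derive_nondecreasing _ (fun=> 0) x (cont0cN gD) dN.
move: (h1 (fun _ _ => lexx 0) xc) (h2 (fun _ _ => lexx 0) xc).
rewrite prim0; lra.
Qed.

Lemma prim_unique0 f F x : cont0c f -> cont0c F ->
  (forall y, 0 < y < c -> is_derive y 1 F (f y)) -> F 0 = 0 ->
  0 <= x <= c -> prim f x = F x.
Proof.
by move=> gf gF dF F0 xc; rewrite -[RHS]subr0 -F0; exact: prim_unique.
Qed.

Lemma prim_eq f g x : cont0c f -> cont0c g ->
  (forall y, 0 < y < c -> f y = g y) -> 0 <= x <= c -> prim f x = prim g x.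
Proof.
move=> gf gg fg xc.
apply: prim_unique0 => //; [exact: prim_cont0c| |exact: prim0].
move=> y yc; rewrite fg //; apply: prim_is_derive => //.
by case/andP: yc => /ltW -> /ltW ->.
Qed.

Lemma oo_cc x : 0 < x < c -> 0 <= x <= c.
Proof. by case/andP => /ltW -> /ltW ->. Qed.

Lemma c_cc : 0 <= c <= c. Proof. by rewrite lexx (ltW c_gt0). Qed.

Lemma prim_add f g x : cont0c f -> cont0c g -> 0 <= x <= c ->
  prim (fun y => f y + g y) x = prim f x + prim g x.
Proof.
move=> gf gg xc.
apply: (@prim_unique0 _ (fun y => prim f y + prim g y)) => //.
- exact: cont0cD.
- by apply: cont0cD; exact: prim_cont0c.
- by move=> y /oo_cc yc; apply: is_deriveD; exact: prim_is_derive.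
by rewrite !prim0 addr0.
Qed.

Lemma prim_scale a f x : cont0c f -> 0 <= x <= c ->
  prim (fun y => a * f y) x = a * prim f x.
Proof.
move=> gf xc.
apply: (@prim_unique0 _ (fun y => a * prim f y)) => //.
- by apply: cont0cM => //; exact: cont0c_cst.
- by apply: cont0cM; [exact: cont0c_cst|exact: prim_cont0c].
- by move=> y /oo_cc yc; apply: is_deriveZ; exact: prim_is_derive.
by rewrite prim0 mulr0.
Qed.

Lemma prim_sub f g x : cont0c f -> cont0c g -> 0 <= x <= c ->
  prim (fun y => f y - g y) x = prim f x - prim g x.
Proof.
move=> gf gg xc.
have -> : (fun y => f y - g y) = fun y => f y + -1 * g y.
  by apply/funext => y; rewrite mulN1r.
rewrite prim_add ?prim_scale ?mulN1r //.
by apply: cont0cM => //; exact: cont0c_cst.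
Qed.

Lemma prim_zero x : 0 <= x <= c -> prim (fun=> 0) x = 0.
Proof.
by move=> xc; apply: (@prim_unique0 _ (fun=> 0)) => //; exact: cont0c_cst.
Qed.

Lemma prim_sum (I : Type) (r : seq I) (P : pred I) (F : I -> R -> R) x :
  (forall i, P i -> cont0c (F i)) -> 0 <= x <= c ->
  prim (fun y => \sum_(i <- r | P i) F i y) x =
  \sum_(i <- r | P i) prim (F i) x.
Proof.
move=> gF xc; elim: r => [|i r IH].
  rewrite big_nil -[RHS](prim_zero xc); congr prim.
  by apply/funext => y; rewrite big_nil.
rewrite big_cons -IH; case: ifP => Pi.
  rewrite -prim_add //; [|exact: gF|exact: cont0c_sum].
  by congr prim; apply/funext => y; rewrite big_cons Pi.
by congr prim; apply/funext => y; rewrite big_cons Pi.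
Qed.

Lemma prim_ge0 f x : cont0c f -> (forall y, 0 < y < c -> 0 <= f y) ->
  0 <= x <= c -> 0 <= prim f x.
Proof.
move=> gf f0 xc; rewrite -(prim0 f).
apply: (@nonneg_derive_nondecreasing _ f) => //; first exact: prim_cont0c.
by move=> y /oo_cc yc; exact: prim_is_derive.
Qed.


End QuarterPeriod.

(** * Division by the sine and iterated integrals *)

Section DivisionBySine.
Variable R : realType.
Implicit Types (f g h F G : R -> R) (x y a b d : R).
Local Notation c := (pi / 2 : R).

Lemma derD f g x a b : is_derive x 1 f a -> is_derive x 1 g b ->
  is_derive x 1 (fun y => f y + g y) (a + b).
Proof. by move=> df dg; exact: is_deriveD. Qed.

Lemma derB f g x a b : is_derive x 1 f a -> is_derive x 1 g b ->
  is_derive x 1 (fun y => f y - g y) (a - b).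
Proof. by move=> df dg; exact: is_deriveB. Qed.

Lemma derM f g x a b : is_derive x 1 f a -> is_derive x 1 g b ->
  is_derive x 1 (fun y => f y * g y) (f x * b + a * g x).
Proof.
move=> df dg; apply: (is_derive_eq (is_deriveM df dg)).
by rewrite /GRing.scale /= [g x * _]mulrC.
Qed.

Lemma derC a x : is_derive x 1 (fun=> a) 0.
Proof. exact: is_derive_cst. Qed.

Lemma derZ a f x d : is_derive x 1 f d -> is_derive x 1 (fun y => a * f y) (a * d).
Proof. by move=> df; exact: is_deriveZ. Qed.

Lemma derX f n x a : is_derive x 1 f a ->
  is_derive x 1 (fun y => f y ^+ n) (n%:R * f x ^+ n.-1 * a).
Proof.
move=> df.
have -> : (fun y => f y ^+ n) = f ^+ n by apply/funext => y; rewrite fctE.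
exact: is_deriveX.
Qed.

Lemma derV f x a : f x != 0 -> is_derive x 1 f a ->
  is_derive x 1 (fun y => (f y)^-1) (- a / f x ^+ 2).
Proof.
move=> f0 df; apply: (is_derive_eq (is_deriveV f0 df)).
by rewrite /GRing.scale /= !mulNr mulrC.
Qed.

Lemma der_id x : is_derive x 1 (fun y : R => y) 1.
Proof. exact: is_derive_id. Qed.

Lemma der_sum (I : Type) (r : seq I) (F : I -> R -> R) (d : I -> R) x :
  (forall i, is_derive x 1 (F i) (d i)) ->
  is_derive x 1 (fun y => \sum_(i <- r) F i y) (\sum_(i <- r) d i).
Proof.
move=> dF; elim: r => [|i r IH].
  have -> : (fun y => \sum_(i <- [::]) F i y) = fun=> 0.
    by apply/funext => y; rewrite big_nil.
  by rewrite big_nil; exact: derC.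
have -> : (fun y => \sum_(j <- i :: r) F j y) =
    fun y => F i y + \sum_(j <- r) F j y.
  by apply/funext => y; rewrite big_cons.
by rewrite big_cons; exact: derD.
Qed.

Lemma der_cos (n : R) x : is_derive x 1 (fun y => cos (n * y)) (- n * sin (n * x)).
Proof.
have := @is_derive1_comp R cos (fun y => n * y) x _ _ (is_derive_cos (n * x))
  (derZ n (der_id x)).
by rewrite mulr1 mulNr mulrC mulNr.
Qed.

Lemma der_sin (n : R) x : is_derive x 1 (fun y => sin (n * y)) (n * cos (n * x)).
Proof.
have := @is_derive1_comp R sin (fun y => n * y) x _ _ (is_derive_sin (n * x))
  (derZ n (der_id x)).
by rewrite mulr1 mulrC.
Qed.

(* The continuous extension of [f / sin] at [0] when [f 0 = 0]. *)
Definition dsin f x : R := if x == 0 then 'D_1 f 0 else f x / sin x.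

Lemma dsinE f x : 0 < x < c -> dsin f x = f x / sin x.
Proof. by rewrite /dsin => /andP[/gt_eqF ->]. Qed.

(** Two-sided at both end points, which primitives satisfy because [prim] is defined on the whole
    line. At 0 it provides the value that makes [dsin f] continuous. *)
Definition derivable0c f := forall x, 0 <= x <= c -> derivable f x 1.

Lemma derivable0c_cont0c f : derivable0c f -> cont0c f.
Proof. by move=> sf x /sf dx; exact/differentiable_continuous/derivable1_diffP. Qed.

Lemma sin_c_gt0 x : 0 < x <= c -> 0 < sin x.
Proof.
case/andP=> x0 xc; apply: sin_gt0_pi; rewrite x0 (le_lt_trans xc) //.
by rewrite ltr_pdivrMr ?ltr0n // ltr_pMr ?pi_gt0 // ltr1n.
Qed.

Lemma prim_derivable0c f : cont0c f -> derivable0c (prim f).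
Proof. by move=> gf x xc; case: (prim_is_derive gf xc). Qed.

Lemma dsin_cont0c f : derivable0c f -> f 0 = 0 -> cont0c (dsin f).
Proof.
move=> sf f0 x xc; have [x0 _] := andP xc.
move: x0; rewrite le_eqVlt => /predU1P[x0|x0].
  have d0 : dsin f 0 = 'D_1 f 0 by rewrite /dsin eqxx.
  rewrite -{}x0; suff: dsin f y @[y --> 0] --> 'D_1 f 0 by rewrite -d0.
  have c0 : 0 <= (0 : R) <= c by rewrite lexx (ltW (c_gt0 _)).
  (* Near 0, f / sin is the quotient of the difference quotients of f and of sin, and the latter
     tends to cos 0 = 1. *)
  have quot (h : R -> R) : derivable h 0 1 -> h 0 = 0 ->
      h y / y @[y --> 0^'] --> 'D_1 h 0.
    move=> hd h0; apply: cvg_trans hd; apply: near_eq_cvg; near=> y.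
    by rewrite /= !addr0 h0 subr0 [_%:A]mulr1 /GRing.scale /= mulrC.
  have q1 := quot f (sf _ c0) f0.
  have q2 := quot sin (@derivable_sin R 0) (@sin0 R).
  have ds : 'D_1 (@sin R) 0 = 1 by rewrite derive_val cos0.
  rewrite ds in q2.
  have q : f y / y * (sin y / y)^-1 @[y --> 0^'] --> 'D_1 f 0.
    rewrite -['D_1 f 0]mulr1 -[X in _ * X]invr1.
    by apply: cvgM => //; apply: cvgV => //; rewrite oner_neq0.
  have {}q : dsin f y @[y --> 0^'] --> 'D_1 f 0.
    apply: cvg_trans q; apply: near_eq_cvg; near=> y.
    have y0 : y != 0 by near: y; exact: nbhs_dnbhs_neq.
    by rewrite /dsin (negPf y0) invfM invrK mulrACA mulVf // mulr1.
  move=> A DA; suff: nbhs (0 : R) (dsin f @^-1` A) by [].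
  rewrite dnbhsE; split; first exact: q.
  by apply/principal_filterP; rewrite /preimage /= d0; exact: nbhs_singleton.
have sx : sin x != 0 by rewrite gt_eqF // sin_c_gt0 // x0; case/andP: xc.
have cq : f y / sin y @[y --> x] --> f x / sin x.
  apply: cvgM; first exact: derivable0c_cont0c.
  by apply: cvgV => //; exact: continuous_sin.
have dx : dsin f x = f x / sin x by rewrite /dsin gt_eqF.
suff: dsin f y @[y --> x] --> f x / sin x by rewrite -dx.
apply: cvg_trans cq; apply: near_eq_cvg; near=> y.
have y0 : 0 < y by near: y; exact: lt_nbhsr.
by rewrite /dsin gt_eqF.
Unshelve. all: by end_near. Qed.

Lemma ibp F G f g x : cont0c f -> cont0c g ->
  (forall y, 0 <= y <= c -> is_derive y 1 F (f y)) ->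
  (forall y, 0 <= y <= c -> is_derive y 1 G (g y)) -> 0 <= x <= c ->
  prim (fun y => F y * g y) x =
  F x * G x - F 0 * G 0 - prim (fun y => f y * G y) x.
Proof.
move=> gf gg dF dG xc.
have gF : cont0c F by move=> y yc; apply: is_derive_cont; exact: dF.
have gG : cont0c G by move=> y yc; apply: is_derive_cont; exact: dG.
apply/eqP; rewrite eq_sym subr_eq eq_sym -prim_add //; try exact: cont0cM.
apply/eqP; apply: (@prim_unique _ _ (fun y => F y * G y)) => //.
- by apply: cont0cD; exact: cont0cM.
- exact: cont0cM.
move=> y /oo_cc yc.
by apply: derM; [exact: dF|exact: dG].
Qed.

Definition sinint f := prim (dsin f).

Lemma sinint_derivable0c f : derivable0c f -> f 0 = 0 -> derivable0c (sinint f).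
Proof. by move=> sf f0; apply: prim_derivable0c; exact: dsin_cont0c. Qed.

Lemma sinint0 f : sinint f 0 = 0.
Proof. exact: prim0. Qed.

Lemma prim_lin a b f g h x : cont0c f -> cont0c g -> cont0c h ->
  (forall y, 0 <= y <= c -> f y = a * g y + b * h y) -> 0 <= x <= c ->
  prim f x = a * prim g x + b * prim h x.
Proof.
move=> gf gg gh e xc.
have gag : cont0c (fun y => a * g y) by apply: cont0cM => //; exact: cont0c_cst.
have gbh : cont0c (fun y => b * h y) by apply: cont0cM => //; exact: cont0c_cst.
rewrite -!prim_scale // -prim_add //; apply: prim_eq => //; first exact: cont0cD.
by move=> y /oo_cc; exact: e.
Qed.

Lemma sinint_lin a b f g h x : derivable0c f -> derivable0c g -> derivable0c h ->
  f 0 = 0 -> g 0 = 0 -> h 0 = 0 ->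
  (forall y, 0 <= y <= c -> f y = a * g y + b * h y) -> 0 <= x <= c ->
  sinint f x = a * sinint g x + b * sinint h x.
Proof.
move=> sf sg sh f0 g0 h0 e xc.
have gf := dsin_cont0c sf f0; have gg := dsin_cont0c sg g0.
have gh := dsin_cont0c sh h0.
have gag : cont0c (fun y => a * dsin g y) by apply: cont0cM => //; exact: cont0c_cst.
have gbh : cont0c (fun y => b * dsin h y) by apply: cont0cM => //; exact: cont0c_cst.
rewrite /sinint -!prim_scale // -prim_add //.
apply: prim_eq => //; first exact: cont0cD.
by move=> y yc; rewrite !dsinE // e ?oo_cc // mulrDl !mulrA.
Qed.

(* An entry [k >= 1] of an index contributes one integration against
   [d theta] followed by [k - 1] integrations against [d theta / sin theta]. *)
Definition entry_int k f := iter k.-1 sinint (prim f).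

Lemma entry_int_derivable0c k f : cont0c f -> derivable0c (entry_int k f) /\ entry_int k f 0 = 0.
Proof.
move=> gf; rewrite /entry_int; elim: k.-1 => [|n [sn zn]] /=.
  by split; [exact: prim_derivable0c|exact: prim0].
by split; [exact: sinint_derivable0c|exact: sinint0].
Qed.

Lemma entry_int_cont0c k f : cont0c f -> cont0c (entry_int k f).
Proof. by move=> gf; apply: derivable0c_cont0c; case: (entry_int_derivable0c k gf). Qed.

(** The linear relation is assumed pointwise on [0, c] because the relations between powers of
    [tanhalf] are established only there. *)
Lemma entry_int_lin k a b f g h x : cont0c f -> cont0c g -> cont0c h ->
  (forall y, 0 <= y <= c -> f y = a * g y + b * h y) -> 0 <= x <= c ->
  entry_int k f x = a * entry_int k g x + b * entry_int k h x.
Proof.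
move=> gf gg gh e; rewrite /entry_int; elim: k.-1 x => [|n IH] x xc /=.
  exact: prim_lin.
have := @entry_int_derivable0c n.+1 f gf; rewrite /entry_int /= => -[sf f0].
have := @entry_int_derivable0c n.+1 g gg; rewrite /entry_int /= => -[sg g0].
have := @entry_int_derivable0c n.+1 h gh; rewrite /entry_int /= => -[sh h0].
exact: (sinint_lin sf sg sh f0 g0 h0 IH xc).
Qed.

Lemma entry_int_ge0 k f x : cont0c f -> (forall y, 0 <= y <= c -> 0 <= f y) ->
  0 <= x <= c -> 0 <= entry_int k f x.
Proof.
move=> gf f0; rewrite /entry_int; elim: k.-1 x => [|n IH] x xc /=.
  by apply: prim_ge0 => // y /oo_cc; exact: f0.
have [sf z] := @entry_int_derivable0c n.+1 f gf.
apply: prim_ge0 => //; first exact: dsin_cont0c.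
move=> y yc; rewrite dsinE // divr_ge0 ?IH ?oo_cc //.
by apply/ltW/sin_c_gt0; case/andP: yc => -> /ltW ->.
Qed.

Definition iterint f (ks : seq nat) := foldl (fun f k => entry_int k f) f ks.

Lemma iterint_lin ks a b f g h x : cont0c f -> cont0c g -> cont0c h ->
  (forall y, 0 <= y <= c -> f y = a * g y + b * h y) -> 0 <= x <= c ->
  iterint f ks x = a * iterint g ks x + b * iterint h ks x.
Proof.
elim: ks f g h => [|k ks IH] f g h gf gg gh e /=; first exact: e.
apply: (IH (entry_int k f) (entry_int k g) (entry_int k h)); try exact: entry_int_cont0c.
by move=> y yc; exact: entry_int_lin.
Qed.

Lemma iterint_ge0 ks f x : cont0c f -> (forall y, 0 <= y <= c -> 0 <= f y) ->
  0 <= x <= c -> 0 <= iterint f ks x.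
Proof.
elim: ks f => [|k ks IH] f gf f0 /=; first exact: f0.
apply: IH; first exact: entry_int_cont0c.
by move=> y; exact: entry_int_ge0.
Qed.

(** With t = tan (theta / 2), d theta = 2 dt / (1 + t^2) and d theta / sin theta = dt / t, and
    [0, c] becomes [0, 1]. *)
Definition tanhalf x : R := sin x / (1 + cos x).

Lemma cos_c_ge0 x : 0 <= x <= c -> 0 <= cos x.
Proof.
case/andP=> x0 xc; apply: cos_ge0_pihalf; rewrite xc andbT.
by rewrite (le_trans _ x0) // oppr_le0 ltW // c_gt0.
Qed.

Lemma is_derive_tanhalf x : 0 <= x <= c -> is_derive x 1 tanhalf (1 + cos x)^-1.
Proof.
move=> /cos_c_ge0 c0.
have n0 : 1 + cos x != 0 by rewrite gt_eqF // ltr_wpDr.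
have dn : is_derive x 1 (fun y => 1 + cos y) (0 + - sin x).
  exact: derD.
have dt := derM (is_derive_sin x) (@derV (fun y => 1 + cos y) x _ n0 dn).
suff <- : sin x * (- (0 + - sin x) / (1 + cos x) ^+ 2) + cos x * (1 + cos x)^-1 =
  (1 + cos x)^-1 by exact: dt.
have s2 : sin x ^+ 2 = 1 - cos x ^+ 2 by rewrite -(cos2Dsin2 x); ring.
by rewrite add0r opprK mulrA -expr2 s2; field.
Qed.

Lemma tanhalf0 : tanhalf 0 = 0.
Proof. by rewrite /tanhalf sin0 mul0r. Qed.

Lemma tanhalf_c : tanhalf c = 1.
Proof. by rewrite /tanhalf sin_pihalf cos_pihalf addr0 divr1. Qed.

Lemma tanhalf_cont0c : cont0c tanhalf.
Proof. by move=> x xc; apply: is_derive_cont; exact: is_derive_tanhalf. Qed.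

Lemma tanhalfX_cont0c m : cont0c (fun x => tanhalf x ^+ m).
Proof. exact/cont0cX/tanhalf_cont0c. Qed.

Lemma tanhalf_01 x : 0 <= x <= c -> 0 <= tanhalf x <= 1.
Proof.
move=> xc; have c0 := cos_c_ge0 xc.
have p : 0 < 1 + cos x by rewrite ltr_wpDr.
rewrite /tanhalf ler_pdivrMr // mul1r; apply/andP; split; last first.
  by rewrite (le_trans (sin_le1 x)) // lerDl.
apply: divr_ge0; [case/andP: xc => x0 xc|exact: ltW].
move: x0; rewrite le_eqVlt => /predU1P[<-|x0]; first by rewrite sin0 lexx.
by apply/ltW/sin_c_gt0; rewrite x0.
Qed.

(* Both sides have derivative [2 t^m t'], because [1 + t^2 = 2 t']. *)
Lemma prim_tanhalf m x : 0 <= x <= c ->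
  prim (fun y => tanhalf y ^+ m) x + prim (fun y => tanhalf y ^+ m.+2) x =
  2 / m.+1%:R * tanhalf x ^+ m.+1.
Proof.
move=> xc; rewrite -prim_add //; try exact: tanhalfX_cont0c.
apply: (@prim_unique0 _ (fun y => tanhalf y ^+ m + tanhalf y ^+ m.+2)
  (fun y => 2 / m.+1%:R * tanhalf y ^+ m.+1)) => //.
- by apply: cont0cD; exact: tanhalfX_cont0c.
- by apply: cont0cM; [exact: cont0c_cst|exact: tanhalfX_cont0c].
- move=> y /oo_cc yc; have c0 := cos_c_ge0 yc.
  have n0 : 1 + cos y != 0 by rewrite gt_eqF // ltr_wpDr.
  apply: (is_derive_eq (derZ _ (derX m.+1 (is_derive_tanhalf yc)))) => /=.
  have s2 : sin y ^+ 2 = 1 - cos y ^+ 2 by rewrite -(cos2Dsin2 y); ring.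
  have t2 : tanhalf y ^+ 2 = 2 / (1 + cos y) - 1.
    by rewrite /tanhalf expr_div_n s2; field.
  have -> : tanhalf y ^+ m.+2 = tanhalf y ^+ m * tanhalf y ^+ 2.
    by rewrite -exprD addn2.
  have m0 : (m.+1%:R : R) != 0 by rewrite pnatr_eq0.
  by rewrite t2; move: (m.+1%:R) m0 => q q0; field; rewrite n0 q0.
by rewrite tanhalf0 expr0n mulr0.
Qed.

Lemma sinint_tanhalf m x : 0 <= x <= c ->
  sinint (fun y => tanhalf y ^+ m.+1) x = tanhalf x ^+ m.+1 / m.+1%:R.
Proof.
move=> xc; rewrite /sinint [RHS]mulrC.
apply: (@prim_unique0 _ _ (fun y => m.+1%:R^-1 * tanhalf y ^+ m.+1)) => //.
- apply: dsin_cont0c; last by rewrite tanhalf0 expr0n.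
  by move=> y yc; case: (derX m.+1 (is_derive_tanhalf yc)).
- by apply: cont0cM; [exact: cont0c_cst|exact: tanhalfX_cont0c].
- move=> y yc; have c0 := cos_c_ge0 (oo_cc yc).
  have n0 : 1 + cos y != 0 by rewrite gt_eqF // ltr_wpDr.
  have s0 : sin y != 0.
    by rewrite gt_eqF // sin_c_gt0 //; case/andP: yc => -> /ltW ->.
  apply: (is_derive_eq (derZ _ (derX m.+1 (is_derive_tanhalf (oo_cc yc))))) => /=.
  have m0 : (m.+1%:R : R) != 0 by rewrite pnatr_eq0.
  rewrite dsinE // exprS {2}/tanhalf; move: (m.+1%:R) m0 => q q0.
  by field; rewrite s0 n0 q0.
by rewrite tanhalf0 expr0n mulr0.
Qed.

Lemma tanhalfX_derivable0c m : derivable0c (fun x => tanhalf x ^+ m).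
Proof. by move=> y yc; case: (derX m (is_derive_tanhalf yc)). Qed.

(** Adding the powers m and m + 2 cancels the denominator 1 + t^2 in the integration against d
    theta. Each later integration against dt / t keeps the power t^(m + 1) and divides by m + 1. *)
Lemma entry_int_tanhalf k m x : 0 <= x <= c ->
  entry_int k.+1 (fun y => tanhalf y ^+ m) x + entry_int k.+1 (fun y => tanhalf y ^+ m.+2) x =
  2 / m.+1%:R ^+ k.+1 * tanhalf x ^+ m.+1.
Proof.
rewrite /entry_int /=; elim: k x => [|k IH] x xc; first by rewrite expr1; exact: prim_tanhalf.
have := @entry_int_derivable0c k.+1 _ (@tanhalfX_cont0c m); rewrite /entry_int /= => -[s0 z0].
have := @entry_int_derivable0c k.+1 _ (@tanhalfX_cont0c m.+2); rewrite /entry_int /= => -[s2 z2].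
set f0 := iter k _ _ in s0 z0 IH *; set f2 := iter k _ _ in s2 z2 IH *.
have t0 : tanhalf 0 ^+ m.+1 = 0 :> R by rewrite tanhalf0 expr0n.
have e y : 0 <= y <= c ->
    f0 y = 2 / m.+1%:R ^+ k.+1 * tanhalf y ^+ m.+1 + -1 * f2 y.
  by move=> yc; rewrite -IH // mulN1r addrK.
have := sinint_lin s0 (@tanhalfX_derivable0c m.+1) s2 z0 t0 z2 e xc.
rewrite sinint_tanhalf // => /= ->.
have : (m.+1%:R : R) != 0 by rewrite pnatr_eq0.
by rewrite [m.+1%:R ^+ k.+2]exprS; move: m.+1%:R => q q0; field; rewrite q0 expf_neq0.
Qed.

End DivisionBySine.

(** * Values at c of the iterated integrals, and Bessel's inequality *)

Section IteratedIntegrals.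
Variable R : realType.
Implicit Types (f g h F G : R -> R) (x y a b d : R).
Local Notation c := (pi / 2 : R).

Definition nint m ks : R := iterint (fun y => tanhalf y ^+ m) ks c.

Lemma nint_rec m k ks :
  nint m (k.+1 :: ks) + nint m.+2 (k.+1 :: ks) =
  2 / m.+1%:R ^+ k.+1 * nint m.+1 ks.
Proof.
rewrite /nint /=.
have gm j : cont0c (entry_int k.+1 (fun y : R => tanhalf y ^+ j)).
  by apply: entry_int_cont0c; exact: tanhalfX_cont0c.
have := @iterint_lin R ks (2 / m.+1%:R ^+ k.+1) (- 1) _ _ _ c (gm m)
  (@tanhalfX_cont0c R m.+1) (gm m.+2).
move=> -> //; first by rewrite mulN1r subrK.
  by move=> y yc; rewrite -entry_int_tanhalf // mulN1r addrK.
exact: c_cc.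
Qed.

Lemma nint_ge0 m ks : 0 <= nint m ks.
Proof.
apply: iterint_ge0; [exact: tanhalfX_cont0c| |exact: c_cc].
by move=> y yc; apply: exprn_ge0; case/andP: (tanhalf_01 yc).
Qed.

Lemma nint_le m ks : nint m ks <= nint 0 ks.
Proof.
have gB : cont0c (fun y : R => tanhalf y ^+ 0 - tanhalf y ^+ m).
  by apply: cont0cB; exact: tanhalfX_cont0c.
have := @iterint_lin R ks 1 1 _ _ _ c (@tanhalfX_cont0c R 0) gB (@tanhalfX_cont0c R m).
rewrite /nint => ->; last exact: c_cc.
  rewrite !mul1r lerDr; apply: iterint_ge0; [exact: gB| |exact: c_cc].
  move=> y yc; rewrite subr_ge0 expr0; case/andP: (tanhalf_01 yc) => t0 t1.
  exact: exprn_ile1.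
by move=> y yc; rewrite !mul1r subrK.
Qed.

(** Both terms on the left of [nint_rec] are non-negative, so either is at most the right-hand side.
    The resulting decay in 1 / m is what makes the boundary terms negligible. *)
Lemma nint_cons_le m k ks : nint m (k.+1 :: ks) <= 2 / m.+1%:R * nint 0 ks.
Proof.
apply: (@le_trans _ _ (2 / m.+1%:R ^+ k.+1 * nint m.+1 ks)).
  by rewrite -nint_rec lerDl nint_ge0.
apply: ler_pM; rewrite ?nint_ge0 ?nint_le //.
rewrite ler_pM2l // lef_pV2 ?posrE ?exprn_gt0 ?ltr0n //.
by rewrite exprS ler_peMr ?exprn_ege1 ?ler1n.
Qed.

Lemma nint_nil m : nint m [::] = 1.
Proof. by rewrite /nint /= tanhalf_c expr1n. Qed.

(* Bessel's inequality bounds the sum of the squared coefficients. *)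
Lemma bessel_cvg0 (phi : nat -> R -> R) kappa f : 0 < kappa ->
  (forall i, cont0c (phi i)) ->
  (forall i j, prim (fun y => phi i y * phi j y) c = (i == j)%:R * kappa) ->
  cont0c f -> prim (fun y => f y * phi n y) c @[n --> \oo] --> (0 : R).
Proof.
move=> k0 gphi orth gf; set a := fun n => prim (fun y => f y * phi n y) c.
have gfp n : cont0c (fun y => f y * phi n y) by exact: cont0cM.
have cc := c_cc R.
have bound n : \sum_(0 <= i < n) a i ^+ 2 <= kappa * prim (fun y => f y * f y) c.
  pose s y := \sum_(0 <= i < n) a i * phi i y.
  have gs : cont0c s.
    by apply: cont0c_sum => i _; apply: cont0cM => //; exact: cont0c_cst.
  have fs : prim (fun y => f y * s y) c = \sum_(0 <= i < n) a i ^+ 2.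
    rewrite (_ : (fun y => _) = fun y => \sum_(0 <= i < n) a i * (f y * phi i y)).
      rewrite prim_sum //; last by move=> i _; apply: cont0cM => //; exact: cont0c_cst.
      by apply: eq_bigr => i _; rewrite prim_scale // expr2.
    by apply/funext => y; rewrite mulr_sumr; apply: eq_bigr => i _; rewrite mulrCA.
  have ps i : (i < n)%N -> prim (fun y => s y * phi i y) c = a i * kappa.
    move=> ni.
    rewrite (_ : (fun y => _) = fun y => \sum_(0 <= j < n) a j * (phi j y * phi i y)).
      rewrite prim_sum //; last first.
        by move=> j _; apply: cont0cM; [exact: cont0c_cst|exact: cont0cM].
      rewrite (eq_bigr (fun j => a j * ((j == i)%:R * kappa))); last first.
        by move=> j _; rewrite prim_scale // ?orth //; exact: cont0cM.
      rewrite big_mkord (bigD1 (Ordinal ni)) //= eqxx mul1r big1 ?addr0 //.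
      by move=> j /negPf; rewrite -val_eqE /= => ->; rewrite mul0r mulr0.
    by apply/funext => y; rewrite mulr_suml; apply: eq_bigr => j _; rewrite mulrA.
  have ss : prim (fun y => s y * s y) c = kappa * \sum_(0 <= i < n) a i ^+ 2.
    rewrite (_ : (fun y => _) = fun y => \sum_(0 <= i < n) a i * (s y * phi i y)).
      rewrite prim_sum //; last first.
        by move=> j _; apply: cont0cM; [exact: cont0c_cst|exact: cont0cM].
      rewrite mulr_sumr; apply: eq_big_nat => i /andP[_ ni].
      by rewrite prim_scale // ?ps //; [rewrite mulrA -expr2 mulrC|exact: cont0cM].
    by apply/funext => y; rewrite {2}/s mulr_sumr; apply: eq_bigr => i _; rewrite mulrCA.
  (* Scaling f by [kappa] instead of dividing s by it: the integral of r^2 is kappa times (kappa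
     times the integral of f^2, minus the sum of the a_i^2). *)
  pose r y := kappa * f y - s y.
  have gr : cont0c r by apply: cont0cB => //; apply: cont0cM => //; exact: cont0c_cst.
  have : 0 <= prim (fun y => r y * r y) c.
    by apply: prim_ge0 => //; [exact: cont0cM|move=> y _; rewrite -expr2 sqr_ge0].
  have g1 : cont0c (fun y => kappa ^+ 2 * (f y * f y)).
    by apply: cont0cM; [exact: cont0c_cst|exact: cont0cM].
  have g2 : cont0c (fun y => -2 * kappa * (f y * s y)).
    by apply: cont0cM; [exact: cont0c_cst|exact: cont0cM].
  have g3 : cont0c (fun y => s y * s y) by exact: cont0cM.
  rewrite (_ : (fun y => r y * r y) = fun y =>
      kappa ^+ 2 * (f y * f y) + -2 * kappa * (f y * s y) + s y * s y); last first.
    by apply/funext => y; rewrite /r; ring.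
  rewrite prim_add ?prim_add ?prim_scale ?fs ?ss //; last exact: cont0cD.
  - move: (\sum_(0 <= i < n) _) (prim _ c) => S P.
    rewrite (_ : _ + _ = kappa * (kappa * P - S)); last by ring.
    by rewrite pmulr_rge0 // subr_ge0.
  - exact: cont0cM.
  - exact: cont0cM.
have cv : cvgn (series (fun i => a i ^+ 2)).
  apply: nondecreasing_is_cvgn.
    by apply/nondecreasing_seqP => n; rewrite !seriesEnat /= big_nat_recr //= lerDl sqr_ge0.
  exists (kappa * prim (fun y => f y * f y) c) => _ [n _ <-].
  exact: bound.
have sq := cvg_series_cvg_0 cv.
apply/cvgr0Pnorm_lt => e e0.
have e2 : 0 < e ^+ 2 by rewrite exprn_gt0.
move/cvgr0Pnorm_lt : sq => /(_ _ e2); apply: filterS => n.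
rewrite normrX => /=; rewrite ltr_pXn2r ?nnegrE //; exact: ltW.
Qed.

End IteratedIntegrals.

(** * Entringer numbers *)

Section EntringerNumbers.
Local Open Scope nat_scope.

Definition downup k (s : 'S_k.+1) : bool :=
  [forall i : 'I_k, (s (widen_ord (leqnSn k) i) < s (lift ord0 i)) == odd i].

Lemma entringerE k j :
  entringer k j = \sum_(s : 'S_k.+1 | downup s) (s ord0 == j :> nat).
Proof.
rewrite /entringer -sum1_card big_mkcond [RHS]big_mkcond /=.
apply: eq_bigr => s _; rewrite inE -/(downup s) andbC.
by case: (downup s) => //=; case: (_ == _).
Qed.

Definition rev_perm k : 'S_k.+1 := perm (@rev_ord_inj k.+1).

Lemma ltn_bump h a b : (bump h a < bump h b) = (a < b).
Proof. by rewrite /bump; lia. Qed.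

(* Removing the first value of a down-up permutation leaves an up-down one;
   reversing the values makes it down-up again. *)
Lemma downup_lift_perm k (J : 'I_k.+2) (u : 'S_k.+1) :
  downup (lift_perm ord0 J (u * rev_perm k)) = downup u && (k - u ord0 < J).
Proof.
have tE x : (u * rev_perm k)%g x = k - u x :> nat by rewrite permM permE /= subSS.
have ltu x := ltn_ord (u x).
have wl (i : 'I_k) : widen_ord (leqnSn k.+1) (lift ord0 i) =
    lift ord0 (widen_ord (leqnSn k) i) by apply: val_inj; rewrite /= /bump.
have w0 : widen_ord (leqnSn k.+1) ord0 = ord0 by apply: val_inj.
apply/forallP/andP => [h|[/forallP h uJ] i].
  split; last first.
    have := h ord0; rewrite w0 lift_perm_id lift_perm_lift /= tE /bump.
    by move: (ltn_ord J) => /=; lia.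
  apply/forallP => i; have := h (lift ord0 i).
  rewrite wl !lift_perm_lift [in odd _]lift0 /= ltn_bump !tE => /eqP e.
  have ne : u (widen_ord (leqnSn k) i) != u (lift ord0 i) :> nat.
    rewrite (inj_eq val_inj) (inj_eq perm_inj) -val_eqE /= /bump /=.
    by rewrite add1n neq_ltn ltnSn.
  apply/eqP; move: ne e (ltu (widen_ord (leqnSn k) i)) (ltu (lift ord0 i)); lia.
case: (unliftP ord0 i) => [i' ->|->].
  rewrite wl !lift_perm_lift [in odd _]lift0 /= ltn_bump !tE.
  have ne : u (widen_ord (leqnSn k) i') != u (lift ord0 i') :> nat.
    rewrite (inj_eq val_inj) (inj_eq perm_inj) -val_eqE /= /bump /=.
    by rewrite add1n neq_ltn ltnSn.
  have /eqP e := h i'.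
  apply/eqP; move: ne e (ltu (widen_ord (leqnSn k) i')) (ltu (lift ord0 i')); lia.
rewrite w0 lift_perm_id lift_perm_lift /= tE /bump.
by apply/eqP; move: uJ (ltn_ord J) => /=; lia.
Qed.

(** Down-up permutations with first value j correspond, by removing that value and reversing the
    others, to down-up permutations u of one element fewer with k - u(0) < j. The sum sorts them by
    i = k - u(0). *)
Lemma entringer_sum k j : j <= k.+1 ->
  entringer k.+1 j = \sum_(i < j) entringer k (k - i).
Proof.
move=> jk; have jk' : j < k.+2 by [].
pose J := Ordinal jk'.
rewrite entringerE.
have -> : \sum_(s : 'S_k.+2 | downup s) (s ord0 == j :> nat) =
    \sum_(s : 'S_k.+2 | downup s && (s ord0 == J)) 1.
  rewrite big_mkcondr /=; apply: eq_bigr => s _.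
  by rewrite -val_eqE /=; case: (_ == _).
rewrite (reindex (fun u : 'S_k.+1 => lift_perm ord0 J (u * rev_perm k))) /=; last first.
  have vinj (u w : 'S_k.+1) :
      lift_perm ord0 J (u * rev_perm k) = lift_perm ord0 J (w * rev_perm k) -> u = w.
    move=> /permP e; apply: (mulIg (rev_perm k)); apply/permP => x.
    by have := e (lift ord0 x); rewrite !lift_perm_lift => /lift_inj.
  have surj (s : 'S_k.+2) : s ord0 = J ->
      exists u : 'S_k.+1, lift_perm ord0 J (u * rev_perm k) = s.
    move=> s0; pose v x := odflt ord0 (unlift J (s (lift ord0 x))).
    have vK x : lift J (v x) = s (lift ord0 x).
      have : J != s (lift ord0 x) by rewrite -s0 (inj_eq perm_inj) neq_lift.
      by rewrite /v => /unlift_some[y e ->].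
    have vi : injective v.
      move=> x y /(congr1 (lift J)); rewrite !vK => /perm_inj; exact: lift_inj.
    exists (perm vi * (rev_perm k)^-1)%g; rewrite mulgKV; apply/permP => x.
    case: (unliftP ord0 x) => [y ->|->]; last by rewrite lift_perm_id.
    by rewrite lift_perm_lift permE vK.
  pose g (s : 'S_k.+2) : 'S_k.+1 :=
    odflt 1%g [pick u | lift_perm ord0 J (u * rev_perm k) == s].
  exists g => [u _|s]; rewrite /g; case: pickP => [w /eqP e|no] //=.
  - exact: vinj.
  - by have := no u; rewrite eqxx.
  - by rewrite inE /= => /andP[_ /eqP /surj[u e]]; have := no u; rewrite e eqxx.
rewrite (eq_bigl (fun u : 'S_k.+1 => downup u && (k - u ord0 < j))); last first.
  by move=> u; rewrite downup_lift_perm lift_perm_id eqxx andbT.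
rewrite big_mkcondr /=.
under [RHS]eq_bigr do rewrite entringerE.
rewrite exchange_big /=; apply: eq_bigr => u _.
have uk := ltn_ord (u ord0).
case: ifP => uj; last first.
  by rewrite big1 // => i _; apply/eqP; rewrite eqb0; apply/eqP; have := ltn_ord i; lia.
rewrite (bigD1 (Ordinal uj)) //= subKn // eqxx big1 // => i; rewrite -val_eqE /= => ne.
by apply/eqP; rewrite eqb0; apply/eqP; have := ltn_ord i; move: ne => /eqP; lia.
Qed.

Lemma entringer00 : entringer 0 0 = 1.
Proof.
rewrite entringerE (bigD1 1%g) /=; last by apply/forallP => -[].
rewrite perm1 big1 // => s /andP[_ /eqP[]]; apply/permP => x; rewrite perm1.
by rewrite [x]ord1 [s _]ord1.
Qed.

Lemma entringer_first0 k : entringer k.+1 0 = 0.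
Proof. by rewrite entringer_sum // big_ord0. Qed.

(** The Seidel-Entringer triangle recurrence, as the difference of two consecutive partial sums. *)
Lemma entringer_rec k j : j <= k ->
  entringer k.+1 j.+1 = entringer k.+1 j + entringer k (k - j).
Proof. by move=> jk; rewrite !entringer_sum ?big_ord_recr // ltnW. Qed.

End EntringerNumbers.

(** * Nested sums *)

Section NestedSums.
Variable R : realType.
Implicit Types (s : R) (ks : seq nat) (a m M : nat).

(* The sign of the whole sum, [s ^ ((m_r - r) / 2)], is distributed over the
   successive gaps; [s = -1] gives [mttv] and [s = 1] gives [mtv]. *)
Fixpoint nsum s M a ks : R :=
  if ks is k :: ks' then
    \sum_(a.+1 <= m < M.+1 | odd (m - a))
      s ^+ (m - a).-1./2 * (2 / m%:R ^+ k) * nsum s M m ks'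
  else 1.

Definition step : rel nat := fun a m => (a < m)%N && odd (m - a).

(** When the entries increase, prescribing alternating parities relative to [a] is the same as
    making every gap odd. The latter is a local condition, so the tuple sum can be peeled one entry
    at a time. *)
Lemma path_step a l : path step a l =
  path ltn a l && [forall j : 'I_(size l), odd (nth 0%N l j) == odd (a + j.+1)].
Proof.
elim: l a => [|b l IH] a.
  by apply/esym/forallP => -[].
rewrite /= {}IH /step; have [ab|] := ltnP a b; last by rewrite !andFb.
rewrite !andTb andbCA; congr andb.
apply/andP/forallP => [[oab /forallP h] j|h].
  case: (unliftP ord0 j) => [i ->|->].
    by rewrite lift0 /= (eqP (h i)); apply/eqP; move: oab ab; lia.
  by rewrite /=; apply/eqP; move: oab ab; lia.
have oab : odd (b - a) by have /eqP := h ord0; rewrite /=; move: ab; lia.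
split=> //; apply/forallP => i; have := h (lift ord0 i).
by rewrite lift0 /= => /eqP ->; apply/eqP; move: oab ab; lia.
Qed.

(** Ensures that the truncated subtraction and the halving in the sign exponent are exact, so that
    the exponent splits additively over the gaps. *)
Lemma path_step_last a l : path step a l ->
  (a + size l <= last a l)%N /\ odd (last a l - a) = odd (size l).
Proof.
elim: l a => [|b l IH] a /=; first by rewrite addn0 subnn.
case/andP => /andP[ab oab] /IH[le o].
split; first by lia.
have -> : (last b l - a = (last b l - b) + (b - a))%N by lia.
by rewrite oddD o oab addbT.
Qed.

Lemma sum_tuple_cons (T : finType) n (P : pred (n.+1.-tuple T))
    (F : n.+1.-tuple T -> R) :
  \sum_(t | P t) F t =
  \sum_(x : T) \sum_(t : n.-tuple T | P (cons_tuple x t)) F (cons_tuple x t).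
Proof.
rewrite pair_big_dep /=.
rewrite (reindex (fun p : T * n.-tuple T => cons_tuple p.1 p.2)) //=.
exists (fun t : n.+1.-tuple T => (thead t, [tuple of behead t])).
  by move=> [x t] _ /=; congr pair; apply: val_inj.
by move=> t _; case/tupleP: t => x t; apply: val_inj.
Qed.

Lemma mono_term_cons k ks M (x : 'I_M.+1) (t : (size ks).-tuple 'I_M.+1) :
  mono_term R (cons_tuple x t : (size (k :: ks)).-tuple 'I_M.+1) =
  (x%:R ^+ k)^-1 * mono_term R t.
Proof.
rewrite /mono_term big_ord_recl; congr (_ * _).
by apply: eq_bigr => j _; rewrite lift0 /= !(tnth_nth x).
Qed.

Lemma half_split (L a x z : nat) : (a < x)%N -> odd (x - a) ->
  (x + z <= L)%N -> odd (L - x) = odd z ->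
  ((L - a - z.+1)./2 = (x - a).-1./2 + (L - x - z)./2)%N.
Proof. lia. Qed.

(** Induction on the index, peeling off the smallest summation variable, which becomes the starting
    point of the remaining sum; hence the arbitrary [a]. *)
Lemma nsum_tuple s ks M a : (a <= M)%N ->
  2 ^+ size ks * \sum_(m : (size ks).-tuple 'I_M.+1 |
      path step a [seq nat_of_ord x | x <- m])
    s ^+ (last a [seq nat_of_ord x | x <- m] - a - size ks)./2 * mono_term R m =
  nsum s M a ks.
Proof.
elim: ks a => [|k ks IH] a aM.
  rewrite expr0 mul1r (bigD1 [tuple]) //= subnn mul1r big1 ?addr0.
    by rewrite /mono_term big_ord0.
  by move=> t /andP[_ /negP[]]; apply/eqP; exact: tuple0.
rewrite sum_tuple_cons mulr_sumr /=.
rewrite (@big_nat_widenl _ _ _ _ 0%N) // big_mkord [RHS]big_mkcond /=.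
apply: eq_bigr => x _; rewrite /step -/step.
case: ifP => [/andP[ox ax]|nx]; last first.
  rewrite big_pred0 ?mulr0 // => t; move: nx; rewrite andbC.
  by rewrite /step; case: (_ && _).
have xM : (x <= M)%N by rewrite -ltnS.
rewrite -(IH x) // 2!mulr_sumr mulr_sumr exprS.
apply: eq_big => t; first by rewrite /step ax ox.
move=> pt; rewrite mono_term_cons.
have /path_step_last[] : path step x [seq nat_of_ord x | x <- t].
  by move: pt; rewrite /step ax ox.
rewrite size_map size_tuple => le odd_last.
set L := last _ _ in le odd_last *.
have -> : ((L - a - (size ks).+1)./2 = (x - a).-1./2 + (L - x - size ks)./2)%N.
  exact: half_split.
rewrite exprD; ring.
Qed.

Lemma alternating_tuple_path r M (m : r.-tuple 'I_M.+1) :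
  alternating_tuple m = path step 0 [seq nat_of_ord x | x <- m].
Proof.
rewrite path_step /alternating_tuple; congr andb.
apply/forallP/forallP => h j.
  have jr : (j < r)%N.
    by have := ltn_ord j; rewrite [X in (_ < X)%N]size_map [X in (_ < X)%N]size_tuple.
  have /eqP e := h (Ordinal jr); apply/eqP/(etrans _ e).
  by rewrite (tnth_nth ord0) (nth_map ord0) ?size_tuple /=.
have jr : (j < size [seq nat_of_ord x | x <- m])%N by rewrite size_map size_tuple.
have /eqP e := h (Ordinal jr); apply/eqP/(etrans _ e).
by rewrite (tnth_nth ord0) (nth_map ord0) ?size_tuple /=.
Qed.

Lemma mttv_partialE ks M : mttv_partial R ks M = nsum (-1) M 0 ks.
Proof.
rewrite -(@nsum_tuple _ ks M 0) //; congr (_ * _).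
apply: eq_big => m; first exact: alternating_tuple_path.
by rewrite subn0.
Qed.

Lemma mtv_partialE ks M : mtv_partial R ks M = nsum 1 M 0 ks.
Proof.
rewrite -(@nsum_tuple _ ks M 0) //; congr (_ * _).
apply: eq_big => m; first exact: alternating_tuple_path.
by rewrite expr1n mul1r.
Qed.

(** The term m = a + 1 is split off. The value a + 2 is excluded by parity, and for the others the
    gap measured from a + 2 is shorter by two, which costs one factor s. For s = -1 this is the
    recursion of [nint_rec]. *)
Lemma nsum_rec s M a k ks : (a < M)%N ->
  nsum s M a (k :: ks) =
  s * nsum s M a.+2 (k :: ks) + 2 / a.+1%:R ^+ k * nsum s M a.+1 ks.
Proof.
move=> aM; rewrite [nsum s M a (k :: ks)]/=.
rewrite big_ltn_cond ?ltnS // subSnn /= expr0 mul1r addrC; congr (_ + _).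
have [aM2|] := ltnP a.+1 M; last first.
  move=> Ma; have -> : M = a.+1 by lia.
  by rewrite /= !big_geq ?mulr0 //.
rewrite big_ltn_cond ?ltnS // subSn // subSnn /= mulr_sumr.
rewrite big_nat_cond [RHS]big_nat_cond; apply: eq_big => m.
  by case: (ltnP a.+2 m) => //= am; congr andb; lia.
case/andP => /andP[am mM] _; rewrite !mulrA -exprS; congr (s ^+ _ * _ * _ * _).
lia.
Qed.

Lemma nsum_ge s M a k ks : (M <= a)%N -> nsum s M a (k :: ks) = 0.
Proof. by move=> Ma /=; rewrite big_geq. Qed.

Definition hsum M : R := \sum_(0 <= j < M) j.+1%:R^-1.

Lemma hsum_ge0 M : 0 <= hsum M.
Proof. by apply: sumr_ge0 => j _; rewrite invr_ge0 ler0n. Qed.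

(* Used on truncation errors, which vanish up to a small amount beyond [M]
   and satisfy the two-step recursion of the sums below [M]. *)
Lemma downward_bound (X : nat -> R) M A B : 0 <= B ->
  (forall m, (M <= m)%N -> `|X m| <= A) ->
  (forall m, (m < M)%N -> `|X m| <= `|X m.+2| + 2 / m.+1%:R * B) ->
  forall m, `|X m| <= A + 2 * B * hsum M.
Proof.
move=> B0 hA hX m.
have A0 : 0 <= A by exact: le_trans (hA M (leqnn M)).
have tail_le i j : (i <= j)%N ->
    \sum_(j <= l < M) (l.+1%:R^-1 : R) <= \sum_(i <= l < M) l.+1%:R^-1.
  move=> ij; have [Mj|/ltnW jM] := leqP M j.
    by rewrite big_geq //; apply: sumr_ge0 => l _; rewrite invr_ge0 ler0n.
  rewrite (@big_cat_nat _ _ _ j i M _ _ ij jM) /= lerDr.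
  by apply: sumr_ge0 => l _; rewrite invr_ge0 ler0n.
(* The recursion advances by two, so only every other harmonic term occurs; bounding by the whole
   tail from i keeps the bound monotone in i. *)
have main n : forall i, (M - i < n)%N ->
    `|X i| <= A + 2 * B * \sum_(i <= j < M) j.+1%:R^-1.
  elim: n => // n IH i Mi; have [Mm|mM] := leqP M i.
    by rewrite big_geq // mulr0 addr0 hA.
  rewrite (le_trans (hX i mM)) //.
  have h : `|X i.+2| <= A + 2 * B * \sum_(i.+1 <= j < M) j.+1%:R^-1.
    apply: (le_trans (IH _ _)); first by lia.
    by rewrite lerD2l ler_wpM2l ?mulr_ge0 // tail_le.
  rewrite (big_ltn mM); set S := \sum_(_ <= _ < _) _ in h *.
  apply: (le_trans (lerD h (lexx _))).
  by rewrite -addrA lerD2l mulrDr addrC lerD2r mulrAC.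
rewrite (le_trans (main (M - m).+1 m (leqnn _))) // lerD2l ler_wpM2l ?mulr_ge0 //.
exact: tail_le.
Qed.

(** H_M <= 1 + log M in exponential form: exp (-x) >= 1 - x at x = 1 / (M + 2) gives exp (1 / (M +
    2)) <= (M + 2) / (M + 1), and these ratios telescope. *)
Lemma expR_hsum M : expR (hsum M.+1) <= expR 1 * M.+1%:R.
Proof.
elim: M => [|M IH]; first by rewrite /hsum big_nat1 invr1 mulr1.
rewrite /hsum big_nat_recr //= expRD -/(hsum _).
have q : expR (M.+2%:R^-1) <= (M.+2%:R / M.+1%:R : R).
  rewrite -lef_pV2 ?posrE ?expR_gt0 ?divr_gt0 ?ltr0n // invf_div -expRN.
  apply: le_trans (expR_ge1Dx _).
  have -> : (M.+1%:R : R) = M.+2%:R - 1 by rewrite -[M.+2%:R]natr1 addrK.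
  have : (M.+2%:R : R) != 0 by rewrite pnatr_eq0.
  by move: (M.+2%:R) => p p0; rewrite mulrBl divff // mul1r.
apply: (le_trans (ler_pM (expR_ge0 _) (expR_ge0 _) IH q)).
by rewrite -mulrA ler_pM2l ?expR_gt0 // mulrCA divff ?mulr1 // pnatr_eq0.
Qed.

Lemma cvg0_sqr_bound (u : nat -> R) K : 0 <= K ->
  (forall n, u n ^+ 2 <= K * n.+1%:R^-1) -> u n @[n --> \oo] --> (0 : R).
Proof.
move=> K0 uK; apply/cvgr0Pnorm_lt => e e0.
have cK : K * n.+1%:R^-1 @[n --> \oo] --> (0 : R).
  rewrite -[0](mulr0 K); apply: cvgM; [exact: cvg_cst|exact: cvg_harmonic].
have e2 : 0 < e ^+ 2 by rewrite exprn_gt0.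
move/cvgr0Pnorm_lt : cK => /(_ _ e2); apply: filterS => n /= h.
rewrite -(@ltr_pXn2r _ 2) ?nnegrE //; last exact: ltW.
rewrite -normrX ger0_norm ?sqr_ge0 //.
by apply: (le_lt_trans (uK n)); apply: le_lt_trans h; exact: ler_norm.
Qed.

(* [(1 + H_M)^(2 r + 1) <= (2 r + 1)! exp (1 + H_M) = O (M)], so the square of
   the sequence is [O (1 / M)]. *)
Lemma hsum_pow_cvg0 r : (1 + hsum M) ^+ r / M.+1%:R @[M --> \oo] --> (0 : R).
Proof.
pose K : R := (r.*2.+1)`!%:R * (expR 1 * expR 1).
apply: (@cvg0_sqr_bound _ K) => [|M].
  by rewrite !mulr_ge0 ?expR_ge0 ?ler0n.
have M0 : 0 < (M.+1%:R : R) by rewrite ltr0n.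
have M0' : (M.+1%:R : R) != 0 by rewrite gt_eqF.
have x1 : 1 <= 1 + hsum M by rewrite lerDl hsum_ge0.
have e1 : expR (1 + hsum M) <= expR 1 * expR 1 * M.+1%:R.
  rewrite expRD -mulrA ler_pM2l ?expR_gt0 //.
  apply: (le_trans _ (expR_hsum M)); rewrite ler_expR /hsum.
  by rewrite [leRHS]big_nat_recr //= lerDl invr_ge0 ler0n.
have e2 : (1 + hsum M) ^+ r.*2.+1 <= K * M.+1%:R.
  have := @expR_ge1Dxn R (1 + hsum M) r.*2 (le_trans ler01 x1).
  move=> h; have : (1 + hsum M) ^+ r.*2.+1 / (r.*2.+1)`!%:R <= expR 1 * expR 1 * M.+1%:R.
    by apply: le_trans e1; apply: le_trans h; rewrite lerDr.
  rewrite ler_pdivrMr ?ltr0n ?fact_gt0 // => h2; apply: (le_trans h2).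
  suff -> : K * M.+1%:R = expR 1 * expR 1 * M.+1%:R * (r.*2.+1)`!%:R by exact: lexx.
  by rewrite /K -mulrA mulrC.
rewrite expr_div_n -exprM muln2.
rewrite ler_pdivrMr ?exprn_gt0 // expr2 mulrA mulfVK //.
by apply: le_trans e2; rewrite ler_weXn2l.
Qed.

Lemma hsum_div_cvg0 : hsum M / M.+1%:R @[M --> \oo] --> (0 : R).
Proof.
apply: (@squeeze_cvgr _ _ _ _ (fun=> 0) (fun M => (1 + hsum M) ^+ 1 / M.+1%:R)).
- near=> M; rewrite divr_ge0 ?hsum_ge0 ?ler0n // expr1 /=.
  by rewrite ler_pM2r ?invr_gt0 ?ltr0n // lerDr.
- exact: cvg_cst.
- exact: hsum_pow_cvg0.
Unshelve. all: by end_near. Qed.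

End NestedSums.

(** * Convergence of the alternating sums to the iterated integrals *)

Section AlternatingSums.
Variable R : realType.
Implicit Types (ks : seq nat).
Local Notation c := (pi / 2 : R).

(** Subtracting [nsum_rec] from [nint_rec] shows that the error for [k :: ks] obeys the two-step
    recursion with the error for [ks] as source. From [M] on the sums are empty and the error is
    [nint] itself, of order 1 / M. Each entry of the index thus costs one factor 1 + H_M. *)
Lemma nint_nsum_err ks : all (leq 1) ks ->
  exists2 C : R, 0 <= C & forall M m, (m <= M)%N ->
    `|nint R m ks - nsum (-1) M m ks| <=
      C * ((1 + hsum R M) ^+ size ks / M.+1%:R).
Proof.
elim: ks => [_|[//|k] ks IH /= /IH[C C0 hC]].
  by exists 0 => // M m _; rewrite nint_nil subrr normr0 mul0r.
pose D := nint R 0 ks; have D0 : 0 <= D by exact: nint_ge0.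
(* 2 D comes from the bound on [nint] beyond [M], and 2 C from the source term summed against 2 / (m
   + 1). *)
exists (2 * D + 2 * C) => [|M m _]; first by rewrite addr_ge0 ?mulr_ge0.
pose B := C * ((1 + hsum R M) ^+ size ks / M.+1%:R).
have H0 := @hsum_ge0 R M.
have x1 : 1 <= 1 + hsum R M by rewrite lerDl.
have B0 : 0 <= B.
  by rewrite mulr_ge0 // divr_ge0 ?ler0n // exprn_ge0 // (le_trans ler01).
apply: (le_trans (@downward_bound R
  (fun m => nint R m (k.+1 :: ks) - nsum (-1) M m (k.+1 :: ks))
  M (2 / M.+1%:R * D) B B0 _ _ m)) => [i Mi|i iM|].
- rewrite nsum_ge // subr0 ger0_norm ?nint_ge0 //.
  apply: (le_trans (@nint_cons_le R _ _ _)); rewrite ler_wpM2r //.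
  by rewrite ler_pM2l // lef_pV2 ?posrE ?ltr0n // ler_nat.
- have /eqP := nint_rec R i k ks; rewrite eq_sym -subr_eq eq_sym => /eqP ->.
  rewrite nsum_rec //.
  rewrite (_ : _ - _ = 2 / i.+1%:R ^+ k.+1 * (nint R i.+1 ks - nsum (-1) M i.+1 ks)
    - (nint R i.+2 (k.+1 :: ks) - nsum (-1) M i.+2 (k.+1 :: ks))); last by ring.
  rewrite (le_trans (ler_normB _ _)) // addrC lerD2l normrM.
  apply: ler_pM => //; last exact: hC.
  rewrite ger0_norm ?divr_ge0 ?exprn_ge0 ?ler0n //.
  rewrite ler_pM2l // lef_pV2 ?posrE ?exprn_gt0 ?ltr0n //.
  by rewrite exprS ler_peMr ?exprn_ege1 ?ler1n.
rewrite /B exprS; set H := hsum R M in H0 x1 *; set q := _ ^+ _.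
have q1 : 1 <= q by exact: exprn_ege1.
have p0 : 0 <= (M.+1%:R^-1 : R) by rewrite invr_ge0 ler0n.
move: (M.+1%:R^-1 : R) p0 => p p0.
have h1 : 0 <= D * p * ((1 + H) * q - 1).
  by rewrite mulr_ge0 ?mulr_ge0 // subr_ge0 mulr_ege1.
have h2 : 0 <= C * p * q by rewrite !mulr_ge0 // (le_trans ler01).
nra.
Qed.

Lemma mttv_partial_cvg ks : all (leq 1) ks ->
  mttv_partial R ks M @[M --> \oo] --> nint R 0 ks.
Proof.
move=> /nint_nsum_err[C C0 hC]; apply/subr_cvg0.
have z : C * ((1 + hsum R M) ^+ size ks / M.+1%:R) @[M --> \oo] --> (0 : R).
  by rewrite -[0](mulr0 C); apply: cvgM; [exact: cvg_cst|exact: hsum_pow_cvg0].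
apply: norm_cvg0; apply: (squeeze_cvgr _ (cvg_cst _) z).
near=> M; rewrite normr_ge0 /= distrC mttv_partialE.
exact: hC.
Unshelve. all: by end_near. Qed.

Lemma mttvE ks : all (leq 1) ks -> mttv R ks = nint R 0 ks.
Proof. by move=> /mttv_partial_cvg; exact: cvg_lim. Qed.

End AlternatingSums.

(** * Fourier coefficients *)

Section FourierCoefficients.
Variable R : realType.
Implicit Types (f g h F G : R -> R) (x y a b d : R) (i j m n : nat).
Local Notation c := (pi / 2 : R).

Lemma sin_even_c j : sin (j.*2%:R * c) = 0.
Proof.
elim: j => [|j IH]; first by rewrite mul0r sin0.
have -> : j.+1.*2%:R * c = j.*2%:R * c + pi.
  by rewrite doubleS -addn2 natrD mulrDl [2 * _]mulrC divfK ?pnatr_eq0.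
by rewrite sinDpi IH oppr0.
Qed.

Lemma cos_even_c j : cos (j.*2%:R * c) = (-1) ^+ j.
Proof.
elim: j => [|j IH]; first by rewrite mul0r cos0.
have -> : j.+1.*2%:R * c = j.*2%:R * c + pi.
  by rewrite doubleS -addn2 natrD mulrDl [2 * _]mulrC divfK ?pnatr_eq0.
by rewrite cosDpi IH exprS mulN1r.
Qed.

Lemma odd_cE j : j.*2.+1%:R * c = j.*2%:R * c + c.
Proof. by rewrite -addn1 natrD mulrDl mul1r. Qed.

Lemma sin_odd_c j : sin (j.*2.+1%:R * c) = (-1) ^+ j.
Proof. by rewrite odd_cE sinDpihalf cos_even_c. Qed.

Lemma cos_odd_c j : cos (j.*2.+1%:R * c) = 0.
Proof. by rewrite odd_cE cosDpihalf sin_even_c oppr0. Qed.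

Lemma cont0c_cos d : cont0c (fun y => cos (d * y)).
Proof. by move=> x _; exact: (is_derive_cont (der_cos d x)). Qed.

Lemma cont0c_sin d : cont0c (fun y => sin (d * y)).
Proof. by move=> x _; exact: (is_derive_cont (der_sin d x)). Qed.

Lemma prim_cos n x : (0 < n)%N -> 0 <= x <= c ->
  prim (fun y => cos (n%:R * y)) x = n%:R^-1 * sin (n%:R * x).
Proof.
move=> n0 xc.
apply: (@prim_unique0 R (fun y => cos (n%:R * y)) (fun y => n%:R^-1 * sin (n%:R * y))).
- exact: cont0c_cos.
- by apply: cont0cM; [exact: cont0c_cst|exact: cont0c_sin].
- move=> y _; apply: (is_derive_eq (derZ _ (der_sin _ _))).
  by rewrite mulrA mulVf ?mul1r // pnatr_eq0 -lt0n.
- by rewrite mulr0 sin0 mulr0.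
- exact: xc.
Qed.

Lemma prim_cst a x : 0 <= x <= c -> prim (fun=> a) x = a * x.
Proof.
move=> xc; apply: (@prim_unique0 R (fun=> a) (fun y => a * y)).
- exact: cont0c_cst.
- by move=> y _; exact: (is_derive_cont (derZ a (der_id y))).
- by move=> y _; apply: (is_derive_eq (derZ a (der_id y))); rewrite mulr1.
- by rewrite mulr0.
- exact: xc.
Qed.

Lemma prim_cos_even j : prim (fun y => cos (j.*2%:R * y)) c = (j == 0)%:R * c.
Proof.
case: j => [|j].
  rewrite mul1r (_ : (fun y => _) = fun=> 1) ?prim_cst ?mul1r ?c_cc //.
  by apply/funext => y; rewrite mul0r cos0.
by rewrite prim_cos ?c_cc // sin_even_c mulr0 mul0r.
Qed.

Lemma prim_cos_diff i j : odd i = odd j ->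
  prim (fun y => cos (i%:R * y - j%:R * y)) c = (i == j)%:R * c.
Proof.
wlog ij : i j / (j <= i)%N.
  move=> wl o; have [/wl ->//|/ltnW /wl] := leqP j i.
  rewrite eq_sym => <- //; congr prim; apply/funext => y.
  by rewrite -cosN opprB.
move=> o; have e : (i - j = (i - j)./2.*2)%N by move: ij o; lia.
have -> : (i == j) = ((i - j)./2 == 0)%N.
  by apply/eqP/eqP => [->|]; [rewrite subnn|move: ij o; lia].
rewrite -prim_cos_even; congr prim; apply/funext => y.
by rewrite -e natrB // mulrBl.
Qed.

Lemma prim_cos_sum i j : odd i = odd j -> (0 < i + j)%N ->
  prim (fun y => cos (i%:R * y + j%:R * y)) c = 0.
Proof.
move=> o ij0; have e : (i + j = (i + j)./2.*2)%N by move: o; lia.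
rewrite (_ : (fun y => _) = fun y => cos ((i + j)./2.*2%:R * y)).
  rewrite prim_cos_even (_ : _ == _ = false) ?mul0r //.
  by apply/eqP; move: e ij0; lia.
by apply/funext => y; rewrite -e natrD mulrDl.
Qed.

Lemma cont0c_cosB i j : cont0c (fun y => cos (i%:R * y - j%:R * y)).
Proof.
rewrite (_ : (fun y => _) = fun y => cos ((i%:R - j%:R) * y)); first exact: cont0c_cos.
by apply/funext => y; rewrite mulrBl.
Qed.

Lemma cont0c_cosD i j : cont0c (fun y => cos (i%:R * y + j%:R * y)).
Proof.
rewrite (_ : (fun y => _) = fun y => cos ((i%:R + j%:R) * y)); first exact: cont0c_cos.
by apply/funext => y; rewrite mulrDl.
Qed.

(** On a quarter period only frequencies of equal parity are orthogonal: then i - j and i + j are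
    even, and cosines of even non-zero frequency integrate to 0 over [0, c]. *)
Lemma prim_cos_cos i j : odd i = odd j -> (0 < i + j)%N ->
  prim (fun y => cos (i%:R * y) * cos (j%:R * y)) c = (i == j)%:R * (c / 2).
Proof.
move=> o ij0.
rewrite (_ : (fun y => _) = fun y => 2^-1 * (cos (i%:R * y - j%:R * y) +
    cos (i%:R * y + j%:R * y))); last first.
  by apply/funext => y; rewrite cosB cosD; field.
have g1 := @cont0c_cosB i j; have g2 := @cont0c_cosD i j.
rewrite prim_scale ?c_cc //; last exact: cont0cD.
rewrite prim_add ?c_cc // prim_cos_diff // prim_cos_sum // addr0.
by rewrite mulrCA [2^-1 * _]mulrC.
Qed.

Lemma prim_sin_sin i j : odd i = odd j -> (0 < i + j)%N ->
  prim (fun y => sin (i%:R * y) * sin (j%:R * y)) c = (i == j)%:R * (c / 2).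
Proof.
move=> o ij0.
rewrite (_ : (fun y => _) = fun y => 2^-1 * (cos (i%:R * y - j%:R * y) -
    cos (i%:R * y + j%:R * y))); last first.
  by apply/funext => y; rewrite cosB cosD; field.
have g1 := @cont0c_cosB i j; have g2 := @cont0c_cosD i j.
rewrite prim_scale ?c_cc //; last exact: cont0cB.
rewrite prim_sub ?c_cc // prim_cos_diff // prim_cos_sum // subr0.
by rewrite mulrCA [2^-1 * _]mulrC.
Qed.

Definition coscoef g m : R := prim (fun y => g y * cos (m%:R * y)) c.
Definition sincoef g m : R := prim (fun y => g y * sin (m%:R * y)) c.

Lemma kappa_gt0 : 0 < c / 2.
Proof. by rewrite divr_gt0 // c_gt0. Qed.

(** The Riemann-Lebesgue lemma along one parity class, the orthogonal family to which Bessel's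
    inequality applies. *)
Lemma coscoef_odd_cvg0 g : cont0c g -> coscoef g n.*2.+1 @[n --> \oo] --> (0 : R).
Proof.
move=> gg; apply: (@bessel_cvg0 R (fun n y => cos (n.*2.+1%:R * y)) _ g kappa_gt0) => //.
  by move=> i; exact: cont0c_cos.
move=> i j; rewrite prim_cos_cos ?addSn //=; last by rewrite !odd_double.
by congr (_%:R * _); rewrite eqSS (inj_eq double_inj).
Qed.

(** Frequency 0 is left out because the constant 1 has squared norm c rather than c / 2. *)
Lemma coscoef_even_cvg0 g : cont0c g -> coscoef g n.+1.*2 @[n --> \oo] --> (0 : R).
Proof.
move=> gg; apply: (@bessel_cvg0 R (fun n y => cos (n.+1.*2%:R * y)) _ g kappa_gt0) => //.
  by move=> i; exact: cont0c_cos.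
move=> i j; rewrite prim_cos_cos //=; last by rewrite !odd_double.
by congr (_%:R * _); rewrite (inj_eq double_inj).
Qed.

Lemma sincoef_even_cvg0 g : cont0c g -> sincoef g n.+1.*2 @[n --> \oo] --> (0 : R).
Proof.
move=> gg; apply: (@bessel_cvg0 R (fun n y => sin (n.+1.*2%:R * y)) _ g kappa_gt0) => //.
  by move=> i; exact: cont0c_sin.
move=> i j; rewrite prim_sin_sin //=; last by rewrite !odd_double.
by congr (_%:R * _); rewrite (inj_eq double_inj).
Qed.

End FourierCoefficients.

(** * Entringer polynomials: derivatives and Fourier coefficients *)

Section EntringerPolynomials.
Variable R : realType.
Implicit Types (f g h F G : R -> R) (x y a b d : R) (i j k m n : nat).
Local Notation c := (pi / 2 : R).

(** Divided powers: differentiation lowers the degree without a factor, and products produce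
    binomial coefficients. *)
Definition dpow n x : R := x ^+ n / n`!%:R.

Lemma dpow0 x : dpow 0 x = 1.
Proof. by rewrite /dpow expr0 fact0 divr1. Qed.

Lemma dpowS0 n : dpow n.+1 0 = 0.
Proof. by rewrite /dpow expr0n mul0r. Qed.

Lemma der_dpowS n f x d : is_derive x 1 f d ->
  is_derive x 1 (fun y => dpow n.+1 (f y)) (dpow n (f x) * d).
Proof.
move=> df.
have -> : (fun y => dpow n.+1 (f y)) = fun y => (n.+1)`!%:R^-1 * f y ^+ n.+1.
  by apply/funext => y; rewrite /dpow mulrC.
apply: (is_derive_eq (derZ _ (derX n.+1 df))).
rewrite factS natrM /dpow /=.
have n0 : (n.+1%:R : R) != 0 by rewrite pnatr_eq0.
have f0 : (n`!%:R : R) != 0 by rewrite pnatr_eq0 -lt0n fact_gt0.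
by move: n0 f0; move: (n.+1%:R) (n`!%:R) => p q p0 q0; field; rewrite p0 q0.
Qed.

Lemma der_dpow0 f x : is_derive x 1 (fun y => dpow 0 (f y)) 0.
Proof.
have -> : (fun y => dpow 0 (f y)) = fun=> 1 by apply/funext => y; rewrite dpow0.
exact: derC.
Qed.

Definition epoly k y : R :=
  \sum_(j < k.+1) (entringer k j)%:R * (dpow j (c - y) * dpow (k - j) y).

Lemma epoly0 y : epoly 0 y = 1.
Proof. by rewrite /epoly big_ord1 entringer00 !dpow0 !mul1r. Qed.

Lemma epoly_c k : epoly k.+1 c = 0.
Proof.
rewrite /epoly big_ord_recl entringer_first0 mul0r add0r big1 // => i _.
by rewrite lift0 subrr dpowS0 mul0r mulr0.
Qed.

Lemma der_cB y : is_derive y 1 (fun z => c - z) (- 1).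
Proof. by apply: (is_derive_eq (derB (derC c y) (der_id y))); rewrite sub0r. Qed.

(** The derivative of each term contributes to two neighbouring products of divided powers.
    Collecting, the coefficient at j is E(k+1, j) - E(k+1, j+1) = - E(k, k-j) by the triangle
    recurrence, and the reversal of j is the reflection y -> c - y. *)
Lemma der_epoly k y : is_derive y 1 (epoly k.+1) (- epoly k (c - y)).
Proof.
pose d1 j := if j is j'.+1 then - (dpow j' (c - y) * dpow (k.+1 - j) y) else 0.
(* The guard matters at j = k + 1: there the truncated k - j is 0 and [dpow 0] is 1, whereas the
   factor being differentiated is constant. *)
pose d2 j := if (j <= k)%N then dpow j (c - y) * dpow (k - j) y else 0.
have dt j : (j <= k.+1)%N -> is_derive y 1
    (fun z => (entringer k.+1 j)%:R * (dpow j (c - z) * dpow (k.+1 - j) z))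
    ((entringer k.+1 j)%:R * (d2 j + d1 j)).
  move=> jk; apply: derZ.
  have dl : is_derive y 1 (fun z => dpow j (c - z))
      (if j is j'.+1 then - dpow j' (c - y) else 0).
    case: j {jk} => [|j]; first exact: der_dpow0.
    by rewrite -mulrN1; apply: der_dpowS; exact: der_cB.
  have dr : is_derive y 1 (fun z => dpow (k.+1 - j) z)
      (if (j <= k)%N then dpow (k - j) y else 0).
    case: leqP => kj.
      by rewrite subSn // -[dpow _ y]mulr1; apply: der_dpowS; exact: der_id.
    rewrite (_ : (k.+1 - j = 0)%N); last by apply/eqP; rewrite subn_eq0.
    exact: der_dpow0.
  apply: (is_derive_eq (derM dl dr)); rewrite /d1 /d2; congr (_ + _).
    by case: leqP => // _; rewrite mulr0.
  by case: j {jk dl dr} => [|j]; rewrite ?mul0r // mulNr.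
have dS := der_sum (index_enum 'I_k.+2) (fun j : 'I_k.+2 => dt j (ltn_ord j)).
apply: (is_derive_eq dS).
under eq_bigr do rewrite mulrDr.
have d2k : d2 k.+1 = 0 by rewrite /d2 ltnn.
rewrite big_split /= big_ord_recr /= d2k mulr0 addr0.
rewrite [X in _ + X]big_ord_recl /= mulr0 add0r.
rewrite -big_split /epoly -sumrN [RHS](reindex_inj rev_ord_inj) /=.
apply: eq_bigr => j _; have jk : (j <= k)%N by rewrite -ltnS.
rewrite /d2 jk /bump add0n subSS subKn // entringer_rec // natrD subKr.
ring.
Qed.

Lemma cont0c_epoly k : cont0c (epoly k).
Proof.
case: k => [|k] x _; last exact: is_derive_cont (der_epoly k x).
by rewrite (_ : epoly 0 = fun=> 1); [exact: cvg_cst|apply/funext => y; rewrite epoly0].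
Qed.

(** The reflection turns the reflected derivative rule into a pair: [epolyc] is a primitive of
    [epoly] one degree lower, and [epoly] one of [- epolyc]. For positive degree it vanishes at 0,
    as division by the sine requires. *)
Definition epolyc k y := epoly k (c - y).

Lemma der_epolyc k y : is_derive y 1 (epolyc k.+1) (epoly k y).
Proof.
have := @is_derive1_comp R (epoly k.+1) (fun z => c - z) y _ _
  (der_epoly k (c - y)) (der_cB y).
by rewrite opprB addrC subrK mulrN1 opprK.
Qed.

Lemma cont0c_epolyc k : cont0c (epolyc k).
Proof.
case: k => [|k] x _; last exact: is_derive_cont (der_epolyc k x).
by rewrite (_ : epolyc 0 = fun=> 1); [exact: cvg_cst|apply/funext => y; exact: epoly0].
Qed.

Lemma epolyc0 k : epolyc k.+1 0 = 0.
Proof. by rewrite /epolyc subr0 epoly_c. Qed.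

Lemma derivable0c_epolyc k : derivable0c (epolyc k.+1).
Proof. by move=> y _; case: (der_epolyc k y). Qed.

Lemma cont0cZ a f : cont0c f -> cont0c (fun y => a * f y).
Proof. by apply: cont0cM; exact: cont0c_cst. Qed.

Lemma prim_sin n x : (0 < n)%N -> 0 <= x <= c ->
  prim (fun y => sin (n%:R * y)) x = n%:R^-1 * (1 - cos (n%:R * x)).
Proof.
move=> n0 xc.
apply: (@prim_unique0 R (fun y => sin (n%:R * y))
  (fun y => n%:R^-1 * (1 - cos (n%:R * y)))).
- exact: cont0c_sin.
- by apply: cont0cZ; apply: cont0cB; [exact: cont0c_cst|exact: cont0c_cos].
- move=> y _; apply: (is_derive_eq (derZ _ (derB (derC 1 y) (der_cos _ _)))).
  by rewrite sub0r mulNr opprK mulrA mulVf ?mul1r // pnatr_eq0 -lt0n.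
- by rewrite mulr0 cos0 subrr mulr0.
- exact: xc.
Qed.

(** Integration by parts exchanges the two families and divides by n = 2 i + 1. No boundary term
    survives, because cos (n c) = 0, sin 0 = 0, [epolyc] vanishes at 0 and [epoly] at c. The signs
    (-1)^i come from sin (n c) in degree 0 and from the minus in [der_epoly]'s reflected rule
    through alternation of the two families. *)
Lemma epoly_coef k i :
  sincoef (epolyc k) i.*2.+1 = ((-1) ^+ i) ^+ k / i.*2.+1%:R ^+ k.+1 /\
  coscoef (epoly k) i.*2.+1 = ((-1) ^+ i) ^+ k.+1 / i.*2.+1%:R ^+ k.+1.
Proof.
have n0 : (i.*2.+1%:R : R) != 0 by rewrite pnatr_eq0.
elim: k => [|k [IHs IHc]].
  split; rewrite /sincoef /coscoef.
    have -> : (fun y => epolyc 0 y * sin (i.*2.+1%:R * y)) =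
        fun y => sin (i.*2.+1%:R * y).
      by apply/funext => y; rewrite /epolyc epoly0 mul1r.
    by rewrite prim_sin ?c_cc // cos_odd_c subr0 mulr1 expr0 mul1r expr1.
  have -> : (fun y => epoly 0 y * cos (i.*2.+1%:R * y)) =
      fun y => cos (i.*2.+1%:R * y).
    by apply/funext => y; rewrite epoly0 mul1r.
  by rewrite prim_cos ?c_cc // sin_odd_c !expr1 mulrC.
split; rewrite /sincoef /coscoef.
  have dG y : 0 <= y <= c -> is_derive y 1
      (fun z => - i.*2.+1%:R^-1 * cos (i.*2.+1%:R * z)) (sin (i.*2.+1%:R * y)).
    move=> _; apply: (is_derive_eq (derZ _ (der_cos _ _))).
    by rewrite mulrA mulrNN mulVf // mul1r.
  rewrite (ibp (@cont0c_epoly k) (@cont0c_sin R _) (fun y _ => der_epolyc k y) dG (c_cc R)).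
  rewrite cos_odd_c epolyc0 !mulr0 mul0r subrr sub0r.
  have -> : (fun y => epoly k y * (- i.*2.+1%:R^-1 * cos (i.*2.+1%:R * y))) =
      fun y => - i.*2.+1%:R^-1 * (epoly k y * cos (i.*2.+1%:R * y)).
    by apply/funext => y; rewrite mulrCA.
  rewrite prim_scale ?c_cc //; last by apply: cont0cM; [exact: cont0c_epoly|exact: cont0c_cos].
  rewrite -/(coscoef _ _) IHc [_ ^+ k.+2]exprS invfM.
  by rewrite mulNr opprK mulrCA.
have dG y : 0 <= y <= c -> is_derive y 1
    (fun z => i.*2.+1%:R^-1 * sin (i.*2.+1%:R * z)) (cos (i.*2.+1%:R * y)).
  move=> _; apply: (is_derive_eq (derZ _ (der_sin _ _))).
  by rewrite mulrA mulVf // mul1r.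
rewrite (ibp (cont0cN (@cont0c_epolyc k)) (@cont0c_cos R _) (fun y _ => der_epoly k y) dG (c_cc R)).
rewrite epoly_c mul0r mulr0 sin0 !mulr0 subrr sub0r.
have -> : (fun y => - epolyc k y * (i.*2.+1%:R^-1 * sin (i.*2.+1%:R * y))) =
    fun y => - i.*2.+1%:R^-1 * (epolyc k y * sin (i.*2.+1%:R * y)).
  by apply/funext => y; rewrite mulrCA mulNr mulrN mulNr.
rewrite prim_scale ?c_cc //; last by apply: cont0cM; [exact: cont0c_epolyc|exact: cont0c_sin].
rewrite -/(sincoef _ _) IHs [_%:R ^+ k.+2]exprS invfM.
rewrite mulNr opprK mulrCA; congr (_ * _).
by rewrite [in RHS]exprS [in RHS]exprS mulrA -expr2 sqrr_sign mul1r.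
Qed.

End EntringerPolynomials.

(** * Telescoping coefficients and pairing with Entringer polynomials of odd degree *)

Section CosineExpansion.
Variable R : realType.
Implicit Types (f g h F G : R -> R) (x y a b d : R) (i j k m n : nat).
Local Notation c := (pi / 2 : R).

Lemma cont0c_mulcos g m : cont0c g -> cont0c (fun y => g y * cos (m%:R * y)).
Proof. by move=> gg; apply: cont0cM => //; exact: cont0c_cos. Qed.

Lemma cont0c_mulsin g m : cont0c g -> cont0c (fun y => g y * sin (m%:R * y)).
Proof. by move=> gg; apply: cont0cM => //; exact: cont0c_sin. Qed.

Lemma sin_oo_neq0 y : 0 < y < c -> sin y != 0.
Proof. by case/andP=> y0 /ltW yc; rewrite gt_eqF // sin_c_gt0 // y0. Qed.

(** cos (j y) - cos ((j + 2) y) = 2 sin ((j + 1) y) sin y, and the factor sin y cancels the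
    denominator. *)
Lemma coscoef_dsin_diff f j : derivable0c f -> f 0 = 0 ->
  coscoef (dsin f) j - coscoef (dsin f) j.+2 = 2 * sincoef f j.+1.
Proof.
move=> sf f0; have gd := dsin_cont0c sf f0; have gf := derivable0c_cont0c sf.
rewrite /coscoef /sincoef -prim_sub ?c_cc //; try exact: cont0c_mulcos.
rewrite -prim_scale ?c_cc //; last exact: cont0c_mulsin.
apply: prim_eq; [|by apply: cont0cZ; exact: cont0c_mulsin| |exact: c_cc].
  by apply: cont0cB; exact: cont0c_mulcos.
move=> y yc; rewrite dsinE //.
have -> : j%:R * y = j.+1%:R * y - y by rewrite -[j.+1%:R]natr1 mulrDl mul1r addrK.
have -> : j.+2%:R * y = j.+1%:R * y + y by rewrite -[j.+2%:R]natr1 mulrDl mul1r.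
rewrite cosB cosD; have := sin_oo_neq0 yc.
by move: (sin y) => s s0; field.
Qed.

(** The boundary term at c is kept: for even j it is the total integral of h up to sign, and it
    becomes the product of a double and a single value in the theorem. *)
Lemma sincoef_prim h j : cont0c h -> (0 < j)%N ->
  sincoef (prim h) j = j%:R^-1 * (coscoef h j - cos (j%:R * c) * prim h c).
Proof.
move=> gh j0; have n0 : (j%:R : R) != 0 by rewrite pnatr_eq0 -lt0n.
have dG y : 0 <= y <= c -> is_derive y 1
    (fun z => - j%:R^-1 * cos (j%:R * z)) (sin (j%:R * y)).
  move=> _; apply: (is_derive_eq (derZ _ (der_cos _ _))).
  by rewrite mulrA mulrNN mulVf // mul1r.
rewrite /sincoef (ibp gh (@cont0c_sin R _) (fun y yc => prim_is_derive gh yc) dG (c_cc R)).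
rewrite prim0 mul0r subr0.
have -> : (fun y => h y * (- j%:R^-1 * cos (j%:R * y))) =
    fun y => - j%:R^-1 * (h y * cos (j%:R * y)).
  by apply/funext => y; rewrite mulrCA.
rewrite prim_scale ?c_cc //; last exact: cont0c_mulcos.
by rewrite -/(coscoef _ _); ring.
Qed.

Lemma sum_odd_cos n y :
  2 * sin y * (\sum_(i < n) cos (i.*2.+1%:R * y)) = sin (n.*2%:R * y).
Proof.
elim: n => [|n IH]; first by rewrite big_ord0 mulr0 mul0r sin0.
rewrite big_ord_recr /= mulrDr IH.
have -> : n.*2%:R * y = n.*2.+1%:R * y - y by rewrite -[n.*2.+1%:R]natr1 mulrDl mul1r addrK.
have -> : n.+1.*2%:R * y = n.*2.+1%:R * y + y.
  by rewrite doubleS -[n.*2.+2%:R]natr1 mulrDl mul1r.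
rewrite sinB sinD; ring.
Qed.

(* Dirichlet kernel: subtracting [f 0 * cos y] leaves a function vanishing at
   [0], and Riemann-Lebesgue applies to its quotient by [sin]. *)
Lemma cos_series_at0 f : derivable0c f ->
  \sum_(i < n) coscoef f i.*2.+1 @[n --> \oo] --> c / 2 * f 0.
Proof.
move=> sf; pose u y := f y - f 0 * cos y.
have du y : is_derive y 1 (fun z : R => f 0 * cos z) (f 0 * - sin y).
  exact: derZ.
have su : derivable0c u.
  move=> y yc; have := derB (derivableP (sf y yc)) (du y).
  by case.
have u0 : u 0 = 0 by rewrite /u cos0 mulr1 subrr.
have gd := dsin_cont0c su u0; have gu := derivable0c_cont0c su.
(* The subtracted cos y is the basis function of frequency 1, so it contributes c / 2 * f 0 through
   i = 0 alone. The remainder is summed in closed form by the kernel. *)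
have e n : \sum_(i < n.+1) coscoef f i.*2.+1 =
    2^-1 * sincoef (dsin u) n.+1.*2 + c / 2 * f 0.
  have gcos : cont0c (fun y : R => cos y) by move=> y _; exact: continuous_cos.
  have split_coef i : coscoef f i.*2.+1 = coscoef u i.*2.+1 +
      f 0 * ((0 == i)%:R * (c / 2)).
    have gfc : cont0c (fun y => f 0 * (cos y * cos (i.*2.+1%:R * y))).
      by apply: cont0cZ; exact: cont0c_mulcos.
    have h := @prim_cos_cos R 1 i.*2.+1; rewrite /= odd_double in h.
    have {h} := h erefl isT; rewrite eqSS -[X in X == _]double0 (inj_eq double_inj) => <-.
    rewrite /coscoef -prim_scale ?c_cc //; last by apply: cont0c_mulcos; exact: cont0c_cos.
    rewrite -prim_add ?c_cc //; [|exact: cont0c_mulcos|]; last first.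
      by apply: cont0cZ; apply: cont0c_mulcos; exact: cont0c_cos.
    congr prim; apply/funext => y; rewrite /u mul1r; ring.
  rewrite (eq_bigr (fun i : 'I_n.+1 => coscoef u i.*2.+1 +
      f 0 * ((0 == i :> nat)%:R * (c / 2)))); last by move=> i _; exact: split_coef.
  rewrite big_split /=; congr (_ + _).
    rewrite /coscoef -prim_sum ?c_cc //; last by move=> i _; exact: cont0c_mulcos.
    rewrite -prim_scale ?c_cc //; last exact: cont0c_mulsin.
    apply: prim_eq; [| |move=> y yc|exact: c_cc].
    - by apply: cont0c_sum => i _; exact: cont0c_mulcos.
    - by apply: cont0cZ; exact: cont0c_mulsin.
    rewrite dsinE // -sum_odd_cos -mulr_sumr.
    have := sin_oo_neq0 yc; move: (sin y) => s s0; field; exact: s0.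
  rewrite -mulr_sumr big_ord_recl eqxx mul1r big1 ?addr0 ?[f 0 * _]mulrC //.
  by move=> i _; rewrite lift0 mul0r.
rewrite -(cvg_shiftS (fun n => \sum_(i < n) coscoef f i.*2.+1)).
rewrite (_ : (fun n => _) = fun n => 2^-1 * sincoef (dsin u) n.+1.*2 + c / 2 * f 0); last first.
  by apply/funext => n; exact: e.
have lim1 : 2^-1 * sincoef (dsin u) n.+1.*2 @[n --> \oo] --> (2^-1 * 0 : R).
  by apply: cvgM; [exact: cvg_cst|exact: sincoef_even_cvg0].
have := cvgD lim1 (cvg_cst (c / 2 * f 0)).
by rewrite mulr0 add0r; exact.
Qed.

(* The second primitive of [g] whose derivative vanishes at [0] and which
   vanishes at [c]: two integrations by parts leave no boundary terms. *)
Definition prim2 g y := prim (prim g) y - prim (prim g) c.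

Lemma der_prim2 g y : cont0c g -> 0 <= y <= c -> is_derive y 1 (prim2 g) (prim g y).
Proof.
move=> gg yc; have dP := prim_is_derive (prim_cont0c gg) yc.
by apply: (is_derive_eq (derB dP (derC (prim (prim g) c) y))); rewrite subr0.
Qed.

Lemma prim2_derivable0c g : cont0c g -> derivable0c (prim2 g).
Proof. by move=> gg y yc; case: (der_prim2 gg yc). Qed.

Lemma coscoef_prim2 g i : cont0c g ->
  coscoef g i.*2.+1 = - (i.*2.+1%:R ^+ 2) * coscoef (prim2 g) i.*2.+1.
Proof.
move=> gg; set m := i.*2.+1.
have gp := prim_cont0c gg; have g2 := derivable0c_cont0c (prim2_derivable0c gg).
have swap f1 f2 : (fun y : R => f1 y * f2 y) = fun y => f2 y * f1 y.
  by apply/funext => y; rewrite mulrC.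
have c0 : prim2 g c = 0 by rewrite /prim2 subrr.
rewrite /coscoef swap.
rewrite (ibp (cont0cZ (a := - m%:R) (@cont0c_sin R m%:R)) gg
  (fun y _ => der_cos m%:R y) (fun y yc => prim_is_derive gg yc) (c_cc R)).
rewrite cos_odd_c prim0 !mul0r mulr0 subrr sub0r.
have -> : (fun y => - m%:R * sin (m%:R * y) * prim g y) =
    fun y => - m%:R * (sin (m%:R * y) * prim g y).
  by apply/funext => y; rewrite mulrA.
rewrite prim_scale ?c_cc //; last by apply: cont0cM => //; exact: cont0c_sin.
rewrite (ibp (cont0cZ (a := m%:R) (@cont0c_cos R m%:R)) gp
  (fun y _ => der_sin m%:R y) (fun y yc => der_prim2 gg yc) (c_cc R)).
rewrite c0 !mulr0 sin0 mul0r subrr sub0r.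
have -> : (fun y => m%:R * cos (m%:R * y) * prim2 g y) =
    fun y => m%:R * (prim2 g y * cos (m%:R * y)).
  by apply/funext => y; rewrite -mulrA [cos _ * _]mulrC.
rewrite prim_scale ?c_cc //; last exact: cont0c_mulcos.
by ring.
Qed.

Lemma prim_epoly_prim2 k g : cont0c g ->
  prim (fun y => @epoly R k.+2 y * g y) c = - prim (fun y => @epoly R k y * prim2 g y) c.
Proof.
move=> gg; have gp := prim_cont0c gg.
have c0 : prim2 g c = 0 by rewrite /prim2 subrr.
rewrite (ibp (cont0cN (@cont0c_epolyc R k.+1)) gg
  (fun y _ => der_epoly k.+1 y) (fun y yc => prim_is_derive gg yc) (c_cc R)).
rewrite epoly_c prim0 !mul0r mulr0 subrr sub0r.
have -> : (fun y => - @epolyc R k.+1 y * prim g y) =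
    fun y => -1 * (@epolyc R k.+1 y * prim g y).
  by apply/funext => y; rewrite mulN1r mulNr.
rewrite prim_scale ?c_cc //; last by apply: cont0cM => //; exact: cont0c_epolyc.
rewrite mulN1r opprK.
rewrite (ibp (@cont0c_epoly R k) gp
  (fun y _ => der_epolyc k y) (fun y yc => der_prim2 gg yc) (c_cc R)).
by rewrite c0 epolyc0 !mulr0 mul0r subrr sub0r.
Qed.

Lemma prim_epoly1 g : cont0c g -> prim (fun y => @epoly R 1 y * g y) c = - prim2 g 0.
Proof.
move=> gg; have gp := prim_cont0c gg.
have d1 y : is_derive y 1 (@epoly R 1) (- 1).
  by have := der_epoly 0 y; rewrite epoly0.
rewrite (ibp (@cont0c_cst R (-1)) gg (fun y _ => d1 y)
  (fun y yc => prim_is_derive gg yc) (c_cc R)).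
rewrite epoly_c prim0 !mul0r mulr0 subrr sub0r prim_scale ?c_cc //.
by rewrite /prim2 prim0 sub0r mulN1r.
Qed.

(** A Parseval formula, since P_(2p+1) has cosine coefficients 1 / n^(2p+2) at odd n; no
    completeness is invoked. Replacing g by [prim2 g] lowers the exponent and the degree by two, up
    to the same sign. The case p = 0 is the evaluation at 0 of a cosine series. *)
Lemma cos_series_epoly p g : cont0c g ->
  \sum_(i < n) coscoef g i.*2.+1 / i.*2.+1%:R ^+ p.+1.*2 @[n --> \oo] -->
  c / 2 * prim (fun y => @epoly R p.*2.+1 y * g y) c.
Proof.
have n0 i : (i.*2.+1%:R : R) != 0 by rewrite pnatr_eq0.
elim: p g => [|p IH] g gg.
  rewrite (prim_epoly1 gg) mulrN.
  rewrite (_ : (fun n => _) = fun n => - \sum_(i < n) coscoef (prim2 g) i.*2.+1).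
    by apply: cvgN; apply: cos_series_at0; exact: prim2_derivable0c.
  apply/funext => n; rewrite -sumrN; apply: eq_bigr => i _.
  by rewrite coscoef_prim2 // mulrAC mulNr mulNr divff ?mul1r // expf_neq0.
rewrite doubleS (prim_epoly_prim2 _ gg) mulrN.
rewrite (_ : (fun n => _) = fun n =>
    - \sum_(i < n) coscoef (prim2 g) i.*2.+1 / i.*2.+1%:R ^+ p.+1.*2).
  by apply: cvgN; apply: IH; apply: derivable0c_cont0c; exact: prim2_derivable0c.
apply/funext => n; rewrite -sumrN; apply: eq_bigr => i _.
rewrite coscoef_prim2 // doubleS -[p.+1.*2.+2]add2n exprD invfM.
rewrite mulrA [- _ * _ / _]mulrAC !mulNr divff ?mul1r ?mulN1r ?mulNr //.
Qed.

End CosineExpansion.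

(** * The double integral *)

Section DoubleIntegral.
Variable R : realType.
Implicit Types (f g h F G : R -> R) (x y a d : R) (i j k m n p q : nat).
Local Notation c := (pi / 2 : R).

Lemma der_dpow_sub n y x :
  is_derive x 1 (fun z => dpow n.+1 (y - z)) (- dpow n (y - x)).
Proof.
rewrite -mulrN1; apply: der_dpowS.
by apply: (is_derive_eq (derB (derC y x) (der_id x))); rewrite sub0r.
Qed.

Lemma cont0c_dpow_sub n y : cont0c (fun x => dpow n (y - x)).
Proof.
case: n => [|n] x _; last exact: is_derive_cont (der_dpow_sub n y x).
exact: is_derive_cont (der_dpow0 (fun z => y - z) x).
Qed.

(** Cauchy's formula for repeated integration. *)
Lemma iter_prim_conv n h y : cont0c h -> 0 <= y <= c ->
  iter n (@prim R) (prim h) y = prim (fun x => dpow n (y - x) * h x) y.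
Proof.
move=> gh yc; elim: n h gh => [|n IH] h gh.
  by congr prim; apply/funext => x; rewrite dpow0 mul1r.
rewrite iterSr IH; last exact: prim_cont0c.
have gN : cont0c (fun x => - dpow n (y - x)) by apply: cont0cN; exact: cont0c_dpow_sub.
rewrite (ibp gN gh (fun x _ => der_dpow_sub n y x) (fun x xc => prim_is_derive gh xc) yc).
rewrite subrr dpowS0 prim0 mul0r mulr0 subrr sub0r.
have -> : (fun x => - dpow n (y - x) * prim h x) =
    fun x => -1 * (dpow n (y - x) * prim h x).
  by apply/funext => x; rewrite mulN1r mulNr.
rewrite prim_scale ?mulN1r ?opprK //.
by apply: cont0cM; [exact: cont0c_dpow_sub|exact: prim_cont0c].
Qed.

Definition upow p : R -> R := iter p (@prim R) (fun=> 1).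

Lemma upowE p x : 0 <= x <= c -> upow p x = dpow p x.
Proof.
elim: p x => [|p IH] x xc; first by rewrite dpow0.
have gu : cont0c (upow p) by elim: p {IH} => [|p]; [exact: cont0c_cst|exact: prim_cont0c].
apply: (@prim_unique0 R (upow p) (fun y => dpow p.+1 y)) => //.
- by move=> y _; exact: is_derive_cont (der_dpowS p (der_id y)).
- move=> y yc; rewrite IH ?oo_cc // -[dpow p y]mulr1.
  exact: der_dpowS (der_id y).
exact: dpowS0.
Qed.

Lemma upow_derivable0c p : derivable0c (upow p.+1).
Proof.
apply: prim_derivable0c.
by elim: p => [|p]; [exact: cont0c_cst|exact: prim_cont0c].
Qed.

Lemma upow0 p : upow p.+1 0 = 0.
Proof. exact: prim0. Qed.

(** The iterated integral once the first raised entry, at position p, is complete and n more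
    integrations against d theta are done; the next operation is the division by the sine of the
    second raised entry. *)
Definition vpow p n : R -> R := iter n (@prim R) (sinint (upow p)).

Lemma vpow_derivable0c p n : derivable0c (vpow p.+1 n) /\ vpow p.+1 n 0 = 0.
Proof.
elim: n => [|n [sn _]].
  split; last exact: prim0.
  by apply: sinint_derivable0c; [exact: upow_derivable0c|exact: upow0].
by split; [apply: prim_derivable0c; exact: derivable0c_cont0c|exact: prim0].
Qed.

Lemma iterint_ones (k : nat -> nat) m n f :
  (forall i, (m <= i < m + n)%N -> k i = 1%N) ->
  iterint f [seq k i | i <- iota m n] = iter n (@prim R) f.
Proof.
elim: n m f => // n IH m f h1; rewrite iterSr /= h1 ?leqnn ?addnS ?ltnS ?leq_addr //.
by apply: IH => i /andP[mi im]; apply: h1; rewrite (ltnW mi) addnS -addSn.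
Qed.

Lemma iterint_cat f r1 r2 : iterint f (r1 ++ r2) = iterint (iterint f r1) r2.
Proof. exact: foldl_cat. Qed.

(** A raised entry adds one [sinint] after its [prim]. For n = 0 both fall on the same entry, which
    equals 3 and applies [sinint] twice in a row, so the formula is uniform in n. *)
Lemma iterint_bump p n l :
  iterint (fun=> 1) (bump_index (p.+1 + n + l) p.+1 (p.+1 + n)) =
  iter l (@prim R) (sinint (vpow p.+1 n)).
Proof.
rewrite /bump_index /mkseq; set k := fun i => _.
have kp i : (i.+1 != p.+1) -> (i.+1 != p.+1 + n)%N -> k i = 1%N.
  by rewrite /k => /negPf -> /negPf ->.
case: n @k kp => [|n] k kp.
  rewrite addn0 addSnnS iotaD map_cat iterint_cat (@iterint_ones _ 0 p); last first.
    by move=> i ip; apply: kp; lia.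
  rewrite [iota _ _]/= [map _ _]/= [iterint _ (_ :: _)]/= -/(iterint _ _).
  rewrite iterint_ones; last by move=> i ip; apply: kp; lia.
  by rewrite /k addn0 eqxx.
have -> : (p.+1 + n.+1 + l = p + (n.+1 + l.+1))%N by lia.
rewrite iotaD map_cat iterint_cat (@iterint_ones _ 0 p); last first.
  by move=> i ip; apply: kp; lia.
rewrite iotaD map_cat iterint_cat [iota _ n.+1]/= [map k (_ :: _)]/=.
rewrite [iterint _ (_ :: _)]/= -/(iterint _ _) (@iterint_ones _ p.+1 n); last first.
  by move=> i ip; apply: kp; lia.
rewrite [iota _ l.+1]/= [map k (_ :: _)]/= [iterint _ (_ :: _)]/= -/(iterint _ _).
rewrite iterint_ones; last by move=> i ip; apply: kp; lia.
have -> : k p = 2%N by rewrite /k eqxx; case: eqP => //; lia.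
have -> : k (0 + p + n.+1)%N = 2%N.
  rewrite /k add0n addSn eqxx; case: eqP => //; lia.
by [].
Qed.

Lemma nint_bump p n l : nint R 0 (bump_index (p.+1 + n + l) p.+1 (p.+1 + n)) =
  prim (fun y => dpow l (c - y) * dsin (vpow p.+1 n) y) c.
Proof.
have [sv v0] := vpow_derivable0c p n.
rewrite /nint iterint_bump iter_prim_conv ?c_cc //; exact: dsin_cont0c.
Qed.

(** By Cauchy's formula every summand is a double integral over 0 < x < y < c with kernel a product
    of divided powers of c - y, y - x and x. If the weighted kernels add up to A(y) B(x), linearity
    separates the integral. *)
Lemma sum_nint_bump (I : Type) (r : seq I) (P : pred I) (w : I -> R)
    (l n p : I -> nat) (A B : R -> R) :
  (forall i : I, P i -> (0 < p i)%N) -> cont0c A -> derivable0c B -> B 0 = 0 ->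
  (forall x y, \sum_(i <- r | P i) w i * (dpow (l i) (c - y) *
     dpow (n i) (y - x) * dpow (p i) x) = A y * B x) ->
  \sum_(i <- r | P i) w i * nint R 0 (bump_index (p i + n i + l i) (p i) (p i + n i)) =
  prim (fun y => A y * dsin (prim (dsin B)) y) c.
Proof.
move=> p0 gA sB B0 id; have gB := dsin_cont0c sB B0.
have gv (i : I) : P i -> derivable0c (vpow (p i) (n i)) /\ vpow (p i) (n i) 0 = 0.
  by move=> /p0; case: (p i) => // q _; exact: vpow_derivable0c.
have gu (i : I) : P i -> cont0c (dsin (upow (p i))).
  move=> /p0; case: (p i) => // q _.
  by apply: dsin_cont0c; [exact: upow_derivable0c|exact: upow0].
have gi (i : I) : P i -> cont0c (fun y => dpow (l i) (c - y) * dsin (vpow (p i) (n i)) y).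
  move=> /gv[sv v0]; apply: cont0cM; first exact: cont0c_dpow_sub.
  exact: dsin_cont0c.
transitivity (prim (fun y => \sum_(i <- r | P i)
    w i * (dpow (l i) (c - y) * dsin (vpow (p i) (n i)) y)) c).
  rewrite prim_sum ?c_cc //; last by move=> i Pi; apply: cont0cZ; exact: gi.
  apply: eq_bigr => i Pi; rewrite prim_scale ?c_cc //; last exact: gi.
  by move: (p0 i Pi); case: (p i) => // q _; rewrite nint_bump.
apply: prim_eq; [| |move=> y yc|exact: c_cc].
- by apply: cont0c_sum => i Pi; apply: cont0cZ; exact: gi.
- apply: cont0cM => //; apply: dsin_cont0c; last exact: prim0.
  exact: prim_derivable0c.
have yc' := oo_cc yc.
rewrite dsinE // mulrA -prim_scale //.
rewrite (eq_bigr (fun i : I => prim (fun x => w i * dpow (l i) (c - y) *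
    (dpow (n i) (y - x) * dsin (upow (p i)) x)) y / sin y)); last first.
  move=> i Pi; rewrite dsinE // prim_scale //; last first.
    by apply: cont0cM; [exact: cont0c_dpow_sub|exact: gu].
  rewrite -iter_prim_conv //; last exact: gu.
  by rewrite /vpow /sinint !mulrA.
rewrite -mulr_suml -prim_sum //; last first.
  move=> i Pi; apply: cont0cZ; apply: cont0cM; [exact: cont0c_dpow_sub|exact: gu].
congr (_ / _); apply: prim_eq => //.
- apply: cont0c_sum => i Pi; apply: cont0cZ; apply: cont0cM; [exact: cont0c_dpow_sub|exact: gu].
- exact: cont0cZ.
move=> x xc; rewrite dsinE // mulrA -id mulr_suml; apply: eq_bigr => i Pi.
by rewrite dsinE // upowE ?oo_cc // !mulrA.
Qed.

(** The origin of the binomials in the theorem: each splits a divided power of degree l + m into an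
    l-factor and an m-factor. *)
Lemma dpow_mul i j x : 'C(i + j, i)%:R * dpow (i + j) x = dpow i x * dpow j x.
Proof.
rewrite /dpow exprD.
have := bin_fact (leq_addr j i); rewrite addKn => e.
have f0 n : (n`!%:R : R) != 0 by rewrite pnatr_eq0 -lt0n fact_gt0.
have ij0 := f0 (i + j)%N; have i0 := f0 i; have j0 := f0 j.
rewrite -e !natrM in ij0 *; move: ij0 i0 j0.
move: (i`!%:R : R) (j`!%:R : R) ('C(_, _)%:R : R) => u v t tuv u0 v0.
have t0 : t != 0 by apply: contraNneq tuv => ->; rewrite mul0r.
by field; rewrite t0 u0 v0.
Qed.

Lemma dpow_add n k (x y : R) : (n <= k)%N ->
  \sum_(i < k.+1) \sum_(j < k.+1 | (i + j == n)%N) dpow i x * dpow j y =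
  dpow n (x + y).
Proof.
move=> nk.
have f0 m : (m`!%:R : R) != 0 by rewrite pnatr_eq0 -lt0n fact_gt0.
transitivity (\sum_(i < k.+1 | (i < n.+1)%N) dpow i x * dpow (n - i) y).
  rewrite [RHS]big_mkcond; apply: eq_bigr => i _; case: ifP => iN.
    have jk : (n - i < k.+1)%N by lia.
    rewrite (bigD1 (Ordinal jk)) /=; last by apply/eqP; lia.
    rewrite big1 ?addr0 // => j /andP[/eqP e /eqP ne]; exfalso; apply: ne.
    by apply: val_inj => /=; lia.
  by rewrite big1 // => j /eqP e; exfalso; move: iN; lia.
rewrite -(big_ord_widen k.+1 (fun i => dpow i x * dpow (n - i) y)) //.
rewrite addrC [RHS]/dpow exprDn mulr_suml; apply: eq_bigr => i _.
have iN : (i <= n)%N by rewrite -ltnS.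
rewrite -(bin_fact iN) /dpow -[_ *+ 'C(n, i)]mulr_natl !natrM.
have := f0 i; have := f0 (n - i)%N.
have : ('C(n, i)%:R : R) != 0 by rewrite pnatr_eq0 -lt0n bin_gt0.
move: (i`!%:R : R) ((n - i)`!%:R : R) ('C(_, _)%:R : R) => u v t t0 v0 u0.
by field; rewrite t0 u0 v0.
Qed.

(** The binomial theorem merges the last two variables. The terms with l1 = 0, absent on the left,
    vanish on the right because e 0 = 0. *)
Lemma sum_trinomial k (e : nat -> R) (x y z : R) : e 0%N = 0 ->
  \sum_(l1 < k.+1) \sum_(l2 < k.+1)
    \sum_(l3 < k.+1 | (l1 + l2 + l3 == k)%N && (0 < l1)%N)
      e l1 * (dpow l1 x * dpow l2 y * dpow l3 z) =
  \sum_(l1 < k.+1) e l1 * (dpow l1 x * dpow (k - l1) (y + z)).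
Proof.
move=> e0; apply: eq_bigr => l1 _; have l1k : (l1 <= k)%N by rewrite -ltnS.
case: (posnP l1) => [->|p1].
  by rewrite e0 mul0r big1 // => l2 _; rewrite big1 // => l3 _; rewrite mul0r.
rewrite -(@dpow_add (k - l1) k) ?leq_subr // !mulr_sumr; apply: eq_bigr => l2 _.
rewrite !mulr_sumr; apply: eq_big => l3 => [|_]; last by rewrite !mulrA.
by rewrite andbT; apply/eqP/eqP; lia.
Qed.

End DoubleIntegral.

(** * The left-hand side as a double integral *)

Section LeftHandSide.
Variable R : realType.
Implicit Types (x y : R).
Local Notation c := (pi / 2 : R).

Lemma sum3_flatten (A B C : finType) (P : A -> B -> C -> bool)
    (F : A -> B -> C -> R) :
  \sum_a \sum_b \sum_(d | P a b d) F a b d =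
  \sum_(u : A * (B * C) | P u.1 u.2.1 u.2.2) F u.1 u.2.1 u.2.2.
Proof.
rewrite (eq_bigr (fun a => \sum_(v : B * C | P a v.1 v.2) F a v.1 v.2)).
  by rewrite pair_big_dep.
by move=> a _; rewrite pair_big_dep.
Qed.

Lemma sum_trinomial_last k (e : nat -> R) (x y z : R) : e 0%N = 0 ->
  \sum_(m1 < k.+1) \sum_(m2 < k.+1)
    \sum_(m3 < k.+1 | (m1 + m2 + m3 == k)%N && (0 < m3)%N)
      e m3 * (dpow m1 x * dpow m2 y * dpow m3 z) =
  \sum_(m3 < k.+1) e m3 * (dpow m3 z * dpow (k - m3) (x + y)).
Proof.
move=> e0; rewrite -sum_trinomial //.
under eq_bigr do under eq_bigr do rewrite big_mkcond.
under eq_bigr do rewrite exchange_big /=.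
rewrite exchange_big /=; apply: eq_bigr => m3 _; apply: eq_bigr => m1 _.
rewrite -big_mkcond; apply: eq_big => m2 => [|_].
  by congr andb; apply/eqP/eqP; lia.
by congr (_ * _); ring.
Qed.

(** The kernel in c - y, y - x, x factors through the two trinomial sums. For the l's, (y - x) + x =
    y leaves P_k1(y); for the m's, (c - y) + (y - x) = c - x leaves P_k3(c - x). *)
Lemma lhs_integral k1 k : (0 < k1)%N -> let k3 := k.+1 in
  \sum_(l1 < k1.+1) \sum_(l2 < k1.+1)
   \sum_(l3 < k1.+1 | (l1 + l2 + l3 == k1)%N && (0 < l1)%N)
   \sum_(m1 < k3.+1) \sum_(m2 < k3.+1)
   \sum_(m3 < k3.+1 | (m1 + m2 + m3 == k3)%N && (0 < m3)%N)
     ('C(l1 + m1, l1) * 'C(l2 + m2, l2) * 'C(l3 + m3, l3) *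
      entringer k1 l1 * entringer k3 m3)%:R *
     mttv R (bump_index (k1 + k3) (l3 + m3) (l3 + m3 + l2 + m2)) =
  prim (fun y => epoly k1 y * dsin (prim (dsin (@epolyc R k3))) y) c.
Proof.
move=> k10 k3.
pose T n := ('I_n.+1 * ('I_n.+1 * 'I_n.+1))%type.
pose P (u : T k1) := (u.1 + u.2.1 + u.2.2 == k1)%N && (0 < u.1)%N.
pose S (v : T k3) := (v.1 + v.2.1 + v.2.2 == k3)%N && (0 < v.2.2)%N.
pose w (i : T k1 * T k3) : R := ('C(i.1.1 + i.2.1, i.1.1) *
  'C(i.1.2.1 + i.2.2.1, i.1.2.1) * 'C(i.1.2.2 + i.2.2.2, i.1.2.2) *
  entringer k1 i.1.1 * entringer k3 i.2.2.2)%:R.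
pose a (i : T k1 * T k3) := (i.1.1 + i.2.1)%N.
pose b (i : T k1 * T k3) := (i.1.2.1 + i.2.2.1)%N.
pose p (i : T k1 * T k3) := (i.1.2.2 + i.2.2.2)%N.
transitivity (\sum_(i : T k1 * T k3 | P i.1 && S i.2)
    w i * nint R 0 (bump_index (p i + b i + a i) (p i) (p i + b i))).
  rewrite sum3_flatten -(pair_big_dep P (fun _ => S)
    (fun u v => w (u, v) * nint R 0 (bump_index (p (u, v) + b (u, v) + a (u, v))
      (p (u, v)) (p (u, v) + b (u, v))))) /=.
  apply: eq_bigr => u /andP[/eqP eu _]; rewrite sum3_flatten.
  apply: eq_bigr => v /andP[/eqP ev _]; rewrite mttvE; last first.
    by apply/allP => q /mapP[j _ ->].
  congr (_ * nint _ _ (bump_index _ _ _)); rewrite /p /b /a /=.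
    move: (nat_of_ord _) (nat_of_ord _) (nat_of_ord _) (nat_of_ord _)
      (nat_of_ord _) (nat_of_ord _) eu ev => *; lia.
  by rewrite addnA.
apply: sum_nint_bump.
- by move=> i /andP[_ /andP[_ v0]]; rewrite addn_gt0 v0 orbT.
- exact: cont0c_epoly.
- exact: derivable0c_epolyc.
- exact: epolyc0.
move=> x y.
have E0 q : (0 < q)%N -> (entringer q 0)%:R = 0 :> R.
  by case: q => // q _; rewrite entringer_first0.
transitivity (\sum_(u : T k1 | P u) \sum_(v : T k3 | S v)
  ((entringer k1 u.1)%:R * (dpow u.1 (c - y) * dpow u.2.1 (y - x) * dpow u.2.2 x)) *
  ((entringer k3 v.2.2)%:R *
     (dpow v.1 (c - y) * dpow v.2.1 (y - x) * dpow v.2.2 x))).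
  rewrite pair_big_dep; apply: eq_bigr => i _; rewrite /w /a /b /p !natrM.
  rewrite (_ : _ * _ = (entringer k1 i.1.1)%:R * (entringer k3 i.2.2.2)%:R *
    (('C(i.1.1 + i.2.1, i.1.1)%:R * dpow (i.1.1 + i.2.1) (c - y)) *
     ('C(i.1.2.1 + i.2.2.1, i.1.2.1)%:R * dpow (i.1.2.1 + i.2.2.1) (y - x)) *
     ('C(i.1.2.2 + i.2.2.2, i.1.2.2)%:R * dpow (i.1.2.2 + i.2.2.2) x))).
    by rewrite !dpow_mul; ring.
  by ring.
under eq_bigr do rewrite -mulr_sumr.
rewrite -mulr_suml; congr (_ * _).
  rewrite -(sum3_flatten (fun l1 l2 l3 : 'I_k1.+1 => (l1 + l2 + l3 == k1)%N && (0 < l1)%N)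
    (fun l1 l2 l3 => (entringer k1 l1)%:R *
      (dpow l1 (c - y) * dpow l2 (y - x) * dpow l3 x))).
  rewrite (sum_trinomial k1 (e := fun j => (entringer k1 j)%:R)) ?E0 //.
  by rewrite /epoly subrK.
rewrite -(sum3_flatten (fun m1 m2 m3 : 'I_k3.+1 => (m1 + m2 + m3 == k3)%N && (0 < m3)%N)
  (fun m1 m2 m3 => (entringer k3 m3)%:R *
    (dpow m1 (c - y) * dpow m2 (y - x) * dpow m3 x))).
rewrite (sum_trinomial_last k3 (e := fun j => (entringer k3 j)%:R)) ?E0 //.
rewrite /epolyc /epoly subKr addrA subrK //.
Qed.

End LeftHandSide.

(** * Limits of the double and triple sums *)

Section TripleSums.
Variable R : realType.
Implicit Types (f g h F G : R -> R) (x y a b d : R) (i j m n M : nat).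
Local Notation c := (pi / 2 : R).

Section FixedIndex.
Variable k : nat.
(** Here k3 = k + 1, and s is the ratio between the signs of consecutive sine coefficients of P_k3(c
    - x). *)
Let s : R := (-1) ^+ k.+1.
Let h : R -> R := dsin (@epolyc R k.+1).
Let Q : R -> R := prim h.
Let g : R -> R := dsin Q.

Lemma cont0c_h : cont0c h.
Proof. by apply: dsin_cont0c; [exact: derivable0c_epolyc|exact: epolyc0]. Qed.

Lemma derivable0c_Q : derivable0c Q.
Proof. exact/prim_derivable0c/cont0c_h. Qed.

Lemma cont0c_g : cont0c g.
Proof. by apply: dsin_cont0c; [exact: derivable0c_Q|exact: prim0]. Qed.

Lemma s_sqr : s * s = 1.
Proof. by rewrite -expr2 sqrr_sign. Qed.

Lemma norm_s i : `|s ^+ i| = 1.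
Proof. by rewrite normrX normr_sign expr1n. Qed.

Lemma coscoef_h0 : coscoef h 0 = Q c.
Proof.
by rewrite /coscoef; congr prim; apply/funext => y; rewrite mul0r cos0 mulr1.
Qed.

(** Up to the factor s^i, this is the recursion [nsum_rec] for the one-entry index k + 2. *)
Lemma coscoef_h_rec i :
  coscoef h i.*2 = coscoef h i.+1.*2 + 2 * (s ^+ i / i.*2.+1%:R ^+ k.+2).
Proof.
have := coscoef_dsin_diff i.*2 (@derivable0c_epolyc R k) (@epolyc0 R k).
move/eqP; rewrite subr_eq addrC => /eqP ->; congr (_ + _ * _).
by rewrite (epoly_coef _ _ _).1 -!exprM mulnC.
Qed.

(** Increments are at most 2 / (p + 1)^2 <= 1 / p - 1 / (p + 2) with p the even frequency. So the
    coefficient's absolute value minus 1 / p is nondecreasing along the sequence; it tends to 0,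
    hence is never positive. Riemann-Lebesgue alone would give no rate. *)
Lemma coscoef_h_bound i : `|coscoef h i.+1.*2| <= i.+1.*2%:R^-1.
Proof.
pose b i := `|coscoef h i.+1.*2| - i.+1.*2%:R^-1.
have bmono : nondecreasing_seq b.
  apply/nondecreasing_seqP => n; rewrite /b coscoef_h_rec.
  have le1 := ler_normD (coscoef h n.+2.*2)
    (2 * (s ^+ n.+1 / n.+1.*2.+1%:R ^+ k.+2)).
  rewrite normrM normrM norm_s mul1r ger0_norm // ger0_norm in le1; last first.
    by rewrite invr_ge0 exprn_ge0.
  suff le2 : 2 * (n.+1.*2.+1%:R ^+ k.+2)^-1 <= n.+1.*2%:R^-1 - (n.+2.*2%:R)^-1 :> R.
    by move: le1 le2; lra.
  have p0 : 0 < (n.+1.*2%:R : R) by rewrite ltr0n.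
  have -> : (n.+1.*2.+1%:R : R) = n.+1.*2%:R + 1 by rewrite natr1.
  have -> : (n.+2.*2%:R : R) = n.+1.*2%:R + 2 by rewrite doubleS -addn2 natrD.
  move: (n.+1.*2%:R : R) p0 => p p0.
  have p1 : 0 < p + 1 by rewrite addr_gt0.
  have p2 : 0 < p + 2 by rewrite addr_gt0.
  apply: (@le_trans _ _ (2 / (p + 1) ^+ 2)).
    rewrite ler_pM2l // lef_pV2 ?posrE ?exprn_gt0 //.
    have -> : (p + 1) ^+ k.+2 = (p + 1) ^+ k * (p + 1) ^+ 2 by rewrite -exprD addn2.
    rewrite ler_peMl ?exprn_ge0 ?(ltW p1) //.
    by rewrite exprn_ege1 // lerDr ltW.
  have -> : p^-1 - (p + 2)^-1 = 2 / (p * (p + 2)).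
    by field; rewrite !gt_eqF.
  rewrite ler_pM2l // lef_pV2 ?posrE ?exprn_gt0 ?mulr_gt0 //.
  by rewrite -subr_ge0 (_ : _ - _ = 1) //; ring.
have cb : b n @[n --> \oo] --> (0 : R).
  rewrite -[0]subr0; apply: cvgB.
    rewrite -[X in _ --> X](normr0 R); apply: cvg_norm.
    exact: (coscoef_even_cvg0 cont0c_h).
  apply: (@squeeze_cvgr _ _ _ _ (fun=> 0) (fun n => n.+1%:R^-1)).
  - near=> n; rewrite invr_ge0 ler0n /= lef_pV2 ?posrE ?ltr0n //.
    by rewrite ler_nat -addnn leq_addr.
  - exact: cvg_cst.
  - exact: cvg_harmonic.
have := nondecreasing_cvgn_le bmono (cvgP _ cb) i.
by rewrite (cvg_lim _ cb) // /b subr_le0.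
Unshelve. all: by end_near. Qed.

(** Coefficient and cut-off sum share one recursion, so their difference changes only by the sign s
    until 2 i reaches [M]. There the sum is empty and the coefficient is at most 1 / (2 i) <= 2 / (M
    + 1); M > 0 excludes i = 0. *)
Lemma inner_err M i : (0 < M)%N ->
  `|s ^+ i * coscoef h i.*2 - nsum s M i.*2 [:: k.+2]| <= 2 / M.+1%:R.
Proof.
move=> M0; have [n] := ubnP (M - i.*2); elim: n i => // n IH i Mn.
have [Mi|iM] := leqP M i.*2.
  rewrite nsum_ge // subr0 normrM norm_s mul1r.
  case: i Mi {Mn IH} => [|i] Mi; first by move: M0 Mi; case: M.
  apply: (le_trans (coscoef_h_bound i)).
  rewrite -[leLHS]mul1r ler_pdivrMr ?ltr0n // mulrAC ler_pdivlMr ?ltr0n // mul1r.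
  by rewrite -natrM ler_nat; move: M0 Mi; rewrite doubleS; lia.
rewrite nsum_rec // mulr1 coscoef_h_rec.
rewrite (_ : _ - _ = s * (s ^+ i.+1 * coscoef h i.+1.*2 - nsum s M i.*2.+2 [:: k.+2])).
  by rewrite normrM -[s]expr1 norm_s mul1r -doubleS; apply: IH; move: Mn iM; rewrite doubleS; lia.
have e1 : s * (s ^+ i.+1) = s ^+ i by rewrite exprS mulrA s_sqr mul1r.
have e2 : s ^+ i * s ^+ i = 1 by rewrite -exprMn s_sqr expr1n.
rewrite [RHS]mulrBr [s * (_ * _)]mulrA e1 mulrDr.
rewrite [s ^+ i * (2 * _)]mulrCA [s ^+ i * (_ / _)]mulrA e2 /=; ring.
Qed.

Lemma nsum_single_cvg : nsum s M 0 [:: k.+2] @[M --> \oo] --> Q c.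
Proof.
have z : 2 / M.+1%:R @[M --> \oo] --> (0 : R).
  rewrite -[X in _ --> X](mulr0 (2 : R)).
  by apply: cvgM; [exact: cvg_cst|exact: cvg_harmonic].
apply/subr_cvg0; apply: norm_cvg0; apply: (squeeze_cvgr _ (cvg_cst _) z).
near=> M; rewrite normr_ge0 /= distrC.
have M0 : (0 < M)%N by near: M; exact: nbhs_infty_gt.
by have := @inner_err M 0 M0; rewrite expr0 mul1r coscoef_h0.
Unshelve. all: by end_near. Qed.

(** The increment splits in two: the boundary term with [Q c] feeds the double sum, and the
    coefficient of [h] feeds the triple sum. *)
Lemma coscoef_g_rec i : coscoef g i.*2.+1 = coscoef g i.+1.*2.+1 +
  2 / i.+1.*2%:R * ((-1) ^+ i * Q c + coscoef h i.+1.*2).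
Proof.
have := coscoef_dsin_diff i.*2.+1 derivable0c_Q (prim0 h).
move/eqP; rewrite subr_eq addrC => /eqP ->; congr (_ + _).
rewrite sincoef_prim //; last exact: cont0c_h.
by rewrite -doubleS cos_even_c exprS /Q; ring.
Qed.

(* The error of the nested sums cut off at [M], as an approximation of the
   coefficients of [g]. *)
Let X M m : R := if odd m then coscoef g m -
    ((-1) ^+ m./2 * nsum (-1) M m [:: 1%N] * Q c +
     s ^+ m./2.+1 * nsum s M m [:: 1%N; k.+2])
  else 0.

(** The source of the recursion is 2 / (m + 1) times the error bounded in [inner_err]. Beyond [M]
    the sums are empty and only the coefficient of [g] remains. *)
Lemma middle_err M A : (0 < M)%N -> 0 <= A ->
  (forall m, (M <= m)%N -> odd m -> `|coscoef g m| <= A) ->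
  forall m, `|X M m| <= A + 2 * (2 / M.+1%:R) * hsum R M.
Proof.
move=> M0 A0 hA; apply: downward_bound => [|m Mm|m mM].
- by rewrite divr_ge0.
- rewrite /X; case: ifP => om; last by rewrite normr0.
  by rewrite !nsum_ge // !mulr0 mul0r addr0 subr0 hA.
rewrite /X [odd m.+2]/= negbK; case: ifP => om; last by rewrite normr0 add0r mulr_ge0 // divr_ge0.
rewrite (_ : coscoef g m - _ = coscoef g m.+2 -
    ((-1) ^+ m.+2./2 * nsum (-1) M m.+2 [:: 1%N] * Q c +
     s ^+ m.+2./2.+1 * nsum s M m.+2 [:: 1%N; k.+2]) +
    2 / m.+1%:R * (coscoef h m./2.+1.*2 -
      s ^+ m./2.+1 * nsum s M m./2.+1.*2 [:: k.+2])).
  rewrite (le_trans (ler_normD _ _)) // lerD2l normrM ger0_norm ?divr_ge0 //.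
  apply: ler_wpM2l; first by rewrite divr_ge0.
  have := @inner_err M m./2.+1 M0.
  set u := nsum _ _ _ _; rewrite -[X in X <= _ -> _]mul1r -(norm_s m./2.+1) -normrM.
  by rewrite mulrBr mulrA -exprMn s_sqr expr1n mul1r.
have em : m = m./2.*2.+1 by move: om; lia.
have em1 : m.+1 = m./2.+1.*2 by move: om; lia.
rewrite {1}em coscoef_g_rec -em1 (nsum_rec _ _ _ mM) (nsum_rec _ _ _ mM) !expr1.
have eh : m.+2./2 = m./2.+1 by [].
have n1 : nsum (-1) M m.+1 [::] = 1 :> R by [].
rewrite eh n1.
rewrite [(-1) ^+ m./2.+1]exprS [s ^+ m./2.+2]exprS; ring.
Qed.

Lemma sum_inv_sqr_le M : \sum_(1 <= m < M.+1) (m%:R ^+ 2)^-1 <= 2 :> R.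
Proof.
case: M => [|M]; first by rewrite big_geq.
suff : \sum_(1 <= m < M.+2) (m%:R ^+ 2)^-1 <= 2 - M.+1%:R^-1 :> R.
  by move=> /le_trans; apply; rewrite gerBl invr_ge0.
elim: M => [|M IH]; first by rewrite big_nat1 expr1n invr1 addrK.
rewrite big_nat_recr //=; apply: (le_trans (lerD IH (lexx _))).
have p0 : 0 < (M.+1%:R : R) by rewrite ltr0n.
have -> : (M.+2%:R : R) = M.+1%:R + 1 by rewrite natr1.
move: (M.+1%:R : R) p0 => p p0.
rewrite -subr_ge0 (_ : _ - _ = (p * (p + 1) ^+ 2)^-1); last first.
  by field; rewrite !gt_eqF // addr_gt0.
by rewrite invr_ge0 mulr_ge0 ?exprn_ge0 ?addr_ge0 // ltW.
Qed.

(** Unfolds the outermost entry. For odd m the exponents (m - 1) / 2 and m / 2 agree after halving,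
    so the extra power in [X] leaves one overall factor s. *)
Lemma outer_sumE k1 M :
  \sum_(1 <= m < M.+1 | odd m) 2 / m%:R ^+ k1 * coscoef g m -
    (Q c * nsum (-1) M 0 [:: k1; 1%N] + s * nsum s M 0 [:: k1; 1%N; k.+2]) =
  \sum_(1 <= m < M.+1) 2 / m%:R ^+ k1 * X M m.
Proof.
have -> : \sum_(1 <= m < M.+1) 2 / m%:R ^+ k1 * X M m =
    \sum_(1 <= m < M.+1 | odd m) 2 / m%:R ^+ k1 * X M m.
  rewrite [RHS]big_mkcond; apply: eq_bigr => m _.
  by rewrite /X; case: ifP => om //; rewrite mulr0.
have e1 : nsum (-1) M 0 [:: k1; 1%N] = \sum_(1 <= m < M.+1 | odd m)
    (-1) ^+ m.-1./2 * (2 / m%:R ^+ k1) * nsum (-1) M m [:: 1%N] :> R.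
  by rewrite [LHS]/=; apply: eq_big => m; rewrite subn0.
have e2 : nsum s M 0 [:: k1; 1%N; k.+2] = \sum_(1 <= m < M.+1 | odd m)
    s ^+ m.-1./2 * (2 / m%:R ^+ k1) * nsum s M m [:: 1%N; k.+2].
  by rewrite [LHS]/=; apply: eq_big => m; rewrite subn0.
rewrite e1 e2 !mulr_sumr -big_split -sumrB; apply: eq_bigr => m om.
have em : m.-1./2 = m./2 by move: om; lia.
rewrite /X om em [s ^+ m./2.+1]exprS.
move: (nsum _ _ _ _) (nsum _ _ _ _) => n1 n2 /=; ring.
Qed.

Lemma sum_odd (F : nat -> R) M :
  \sum_(1 <= m < M.+1 | odd m) F m = \sum_(i < M.+1./2) F i.*2.+1.
Proof.
elim: M => [|M IH]; first by rewrite big_geq // big_ord0.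
rewrite big_mkcond big_nat_recr // -big_mkcond IH.
case: ifP => oM.
  have -> : M.+2./2 = M.+1./2.+1 by move: oM; lia.
  by rewrite big_ord_recr /=; congr (_ + F _); move: oM; lia.
have -> : M.+2./2 = M.+1./2 by move: oM; lia.
exact: addr0.
Qed.

Lemma outer_err_cvg0 p :
  \sum_(1 <= m < M.+1) 2 / m%:R ^+ p.+1.*2 * X M m @[M --> \oo] --> (0 : R).
Proof.
apply/cvgr0Pnorm_le => e e0.
(* 20 = 2 * 5 * 2: the 2 of the weights, the bound 5 d = d + 4 d on [X], and the bound 2 on the sum
   of 1 / m^2. *)
have [d d0 ed] : exists2 d : R, 0 < d & e = 20 * d.
  by exists (e / 20); rewrite ?divr_gt0 // mulrC divfK // pnatr_eq0.
have : \forall n \near \oo, `|coscoef g n.*2.+1| <= d.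
  by move/cvgr0Pnorm_le : (coscoef_odd_cvg0 cont0c_g); exact.
case=> N _ hN; near=> M.
have M0 : (0 < M)%N by near: M; exact: nbhs_infty_gt.
have MN : (N.*2 <= M)%N by near: M; exact: nbhs_infty_ge.
have hM : hsum R M / M.+1%:R <= d.
  apply: (le_trans (ler_norm _)); near: M.
  by move/cvgr0Pnorm_le : (@hsum_div_cvg0 R); exact.
have bX m : `|X M m| <= 5 * d.
  apply: (le_trans (@middle_err M d M0 (ltW d0) _ m)) => [i Mi oi|].
    have -> : i = i./2.*2.+1 by move: oi; lia.
    by apply: hN => /=; move: MN Mi oi; lia.
  rewrite (_ : _ + _ = d + 4 * (hsum R M / M.+1%:R)); last by ring.
  by move: hM; move: (hsum R M / _) => u hu; lra.
apply: (@le_trans _ _ (\sum_(1 <= m < M.+1) 2 * (5 * d) * (m%:R ^+ 2)^-1)).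
  apply: (le_trans (ler_norm_sum _ _ _)); rewrite big_nat [leRHS]big_nat.
  apply: ler_sum => m /andP[m1 _].
  have m0 : 0 < (m%:R : R) by rewrite ltr0n.
  rewrite normrM [leRHS]mulrAC; apply: ler_pM => //.
  rewrite ger0_norm; last by apply: divr_ge0 => //; apply: exprn_ge0; exact: ltW.
  rewrite ler_pM2l // lef_pV2 ?posrE ?exprn_gt0 //.
  by apply: ler_weXn2l; rewrite ?ler1n // doubleS.
rewrite -mulr_sumr; have := sum_inv_sqr_le M.
move: (\sum_(_ <= _ < _) _) => S S2.
apply: (@le_trans _ _ (2 * (5 * d) * 2)).
  by apply: ler_wpM2l => //; rewrite !mulr_ge0 // ltW.
by rewrite ed; lra.
Unshelve. all: by end_near. Qed.

(** The partial sums on the left differ from the weighted cosine series of [g] by an error tending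
    to 0. The weight 2 turns the c / 2 of that series into c. *)
Lemma outer_cvg p : Q c * nsum (-1) M 0 [:: p.+1.*2; 1%N] +
    s * nsum s M 0 [:: p.+1.*2; 1%N; k.+2] @[M --> \oo] -->
  c * prim (fun y => epoly p.*2.+1 y * g y) c.
Proof.
set S := fun M : nat => \sum_(1 <= m < M.+1 | odd m)
  2 / m%:R ^+ p.+1.*2 * coscoef g m.
have cS : S M @[M --> \oo] --> c * prim (fun y => epoly p.*2.+1 y * g y) c.
  have half_oo : M.+1./2 @[M --> \oo] --> \oo.
    apply/cvgnyPge => A; near=> M.
    have : (A.*2 <= M)%N by near: M; exact: nbhs_infty_ge.
    by lia.
  have h1 : \sum_(i < M.+1./2) coscoef g i.*2.+1 / i.*2.+1%:R ^+ p.+1.*2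
      @[M --> \oo] --> c / 2 * prim (fun y => epoly p.*2.+1 y * g y) c.
    exact: (cvg_comp _ _ half_oo (@cos_series_epoly R p g cont0c_g)).
  have -> : c * prim (fun y => epoly p.*2.+1 y * g y) c =
      2 * (c / 2 * prim (fun y => epoly p.*2.+1 y * g y) c).
    by rewrite mulrA mulrC [2 * _]mulrC divfK // mulrC.
  have -> : S = fun M => 2 * \sum_(i < M.+1./2) coscoef g i.*2.+1 / i.*2.+1%:R ^+ p.+1.*2.
    apply/funext => M; rewrite /S sum_odd /= mulr_sumr; apply: eq_bigr => i _.
    by rewrite mulrAC mulrA.
  by apply: cvgM h1; exact: cvg_cst.
have dS := cvgB cS (@outer_err_cvg0 p); rewrite subr0 in dS.
have -> : (fun M => Q c * nsum (-1) M 0 [:: p.+1.*2; 1%N] +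
    s * nsum s M 0 [:: p.+1.*2; 1%N; k.+2]) =
    fun M => S M - \sum_(1 <= m < M.+1) 2 / m%:R ^+ p.+1.*2 * X M m.
  by apply/funext => M; rewrite /S /= -outer_sumE subKr.
exact: dS.
Unshelve. all: by end_near. Qed.

End FixedIndex.
End TripleSums.

(** * Assembly of the two parities of [k3] *)

Theorem theorem3 (R : realType) (k1 k3 : nat) (k1_odd : odd k1)
    (k3_gt0 : (0 < k3)%N) :
  mttv R [:: 1%N] *
  (\sum_(l1 < k1.+1) \sum_(l2 < k1.+1)
   \sum_(l3 < k1.+1 | (l1 + l2 + l3 == k1)%N && (0 < l1)%N)
   \sum_(m1 < k3.+1) \sum_(m2 < k3.+1)
   \sum_(m3 < k3.+1 | (m1 + m2 + m3 == k3)%N && (0 < m3)%N)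
     ('C(l1 + m1, l1) * 'C(l2 + m2, l2) * 'C(l3 + m3, l3) *
      entringer k1 l1 * entringer k3 m3)%:R *
     mttv R (bump_index (k1 + k3) (l3 + m3) (l3 + m3 + l2 + m2)))
  = if odd k3 then
      mttv R [:: k1.+1; 1%N] * mttv R [:: k3.+1]
      - mttv R [:: k1.+1; 1%N; k3.+1]
    else
      mttv R [:: k1.+1; 1%N] * mtv R [:: k3.+1]
      + mtv R [:: k1.+1; 1%N; k3.+1].
Proof.
case: k3 k3_gt0 => // k _.
have [p ek1] : exists p, k1 = p.*2.+1 by exists k1./2; move: k1_odd; lia.
rewrite lhs_integral; last by rewrite ek1.
set J := prim _ _.
have m1 : mttv R [:: 1%N] = pi / 2.
  by rewrite mttvE // /nint /= /entry_int /= prim_cst ?mul1r // c_cc.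
set s : R := (-1) ^+ k.+1.
set q := prim (dsin (@epolyc R k.+1)) (pi / 2).
have c1 : mttv_partial R [:: k1.+1; 1%N] M @[M --> \oo] -->
    mttv R [:: k1.+1; 1%N].
  by rewrite [X in _ --> X]mttvE //; exact: mttv_partial_cvg.
have cQ : nsum s M 0 [:: k.+2] @[M --> \oo] --> q by exact: nsum_single_cvg.
(* The limit of the triple sum is obtained by subtraction: the combination with the double sum
   converges, and so does the double sum alone. *)
have c3 : s * nsum s M 0 [:: k1.+1; 1%N; k.+2] @[M --> \oo] -->
    pi / 2 * J - q * mttv R [:: k1.+1; 1%N].
  have cJ := @outer_cvg R k p; rewrite -ek1 in cJ.
  have -> : (fun M => s * nsum s M 0 [:: k1.+1; 1%N; k.+2]) = fun M =>
      (q * nsum (-1) M 0 [:: p.+1.*2; 1%N] +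
       s * nsum s M 0 [:: p.+1.*2; 1%N; k.+2]) -
      q * mttv_partial R [:: k1.+1; 1%N] M.
    apply/funext => M; rewrite mttv_partialE.
    have -> : p.+1.*2 = k1.+1 by rewrite ek1.
    by rewrite addrAC subrr add0r.
  by apply: cvgB; [exact: cJ|apply: cvgM c1; exact: cvg_cst].
rewrite m1 /=; case: ifP => ok.
  have s1 : s = -1 by rewrite /s -signr_odd /= ok.
  rewrite s1 in cQ c3.
  have e1 : mttv R [:: k.+2] = q.
    apply: cvg_lim => //; rewrite (_ : mttv_partial R _ = fun M => nsum (-1) M 0 [:: k.+2]) //.
    by apply/funext => M; rewrite mttv_partialE.
  have e3 : mttv R [:: k1.+1; 1%N; k.+2] = - (pi / 2 * J - q * mttv R [:: k1.+1; 1%N]).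
    apply: cvg_lim => //.
    rewrite (_ : mttv_partial R _ = fun M => - (-1 * nsum (-1) M 0 [:: k1.+1; 1%N; k.+2])).
      exact: cvgN.
    by apply/funext => M; rewrite mttv_partialE mulN1r opprK.
  by rewrite e1 e3; ring.
have s1 : s = 1 by rewrite /s -signr_odd /= ok.
rewrite s1 in cQ c3.
have e1 : mtv R [:: k.+2] = q.
  apply: cvg_lim => //; rewrite (_ : mtv_partial R _ = fun M => nsum 1 M 0 [:: k.+2]) //.
  by apply/funext => M; rewrite mtv_partialE.
have e3 : mtv R [:: k1.+1; 1%N; k.+2] = pi / 2 * J - q * mttv R [:: k1.+1; 1%N].
  apply: cvg_lim => //.
  rewrite (_ : mtv_partial R _ = fun M => 1 * nsum 1 M 0 [:: k1.+1; 1%N; k.+2]) //.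
  by apply/funext => M; rewrite mtv_partialE mul1r.
by rewrite e1 e3; ring.
Qed.
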